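(* Let $(\mathcal{C},\mathbb{E},\mathfrak{s})$ be an extriangulated category satisfying weak idempotent completeness (WIC), and let $\xi$ be a proper class of $\mathbb{E}$-triangles such that $\mathcal{C}$ has enough $\xi$-projectives and enough $\xi$-injectives. Assume that $\mathcal{C}$ satisfies Condition $(\star)$: if $N\in\mathcal{C}$ and $M\in\widetilde{\mathcal{P}}(\xi)$ are such that $\xi\mathrm{xt}^i_\xi(M,N)=0$ for all $i\ge1$, then $\mathcal{C}(M,N)\cong\xi\mathrm{xt}^0_\xi(M,N)$ (via the natural map); dually, if $N\in\mathcal{C}$ and $M\in\widetilde{\mathcal{I}}(\xi)$ are such that $\xi\mathrm{xt}^i_\xi(N,M)=0$ for all $i\ge1$, then $\mathcal{C}(N,M)\cong\xi\mathrm{xt}^0_\xi(N,M)$ (via the natural map). If $\mathcal{P}(\xi)$ is a generating subcategory of $\mathcal{C}$ and $\mathcal{I}(\xi)$ is a cogenerating subcategory of $\mathcal{C}$, then $$\sup\{\xi\text{-}\mathcal{G}\mathrm{pd}\,M\mid M\in\mathcal{C}\}=\sup\{\xi\text{-}\mathcal{G}\mathrm{id}\,M\mid M\in\mathcal{C}\}.$$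
   Context: **Extriangulated categories (Nakaoka–Palu).** Let $\mathcal{C}$ be an additive category and $\mathbb{E}:\mathcal{C}^{\mathrm{op}}\times\mathcal{C}\to\mathrm{Ab}$ an additive bifunctor. For $\delta\in\mathbb{E}(C,A)$, $a:A\to A'$, $c:C'\to C$ write $a_*\delta=\mathbb{E}(C,a)(\delta)$, $c^*\delta=\mathbb{E}(c,A)(\delta)$. A morphism from $\delta\in\mathbb{E}(C,A)$ to $\delta'\in\mathbb{E}(C',A')$ is a pair $(a:A\to A',c:C\to C')$ with $a_*\delta=c^*\delta'$. Sequences $A\xrightarrow{x}B\xrightarrow{y}C$ and $A\xrightarrow{x'}B'\xrightarrow{y'}C$ are equivalent if there is an isomorphism $b:B\to B'$ with $bx=x'$, $y'b=y$; $[\,\cdot\,]$ denotes the class. A realization $\mathfrak{s}$ assigns to each $\delta\in\mathbb{E}(C,A)$ a class $\mathfrak{s}(\delta)=[A\xrightarrow{x}B\xrightarrow{y}C]$ such that for every morphism $(a,c):\delta\to\delta'$ with $\mathfrak{s}(\delta')=[A'\xrightarrow{x'}B'\xrightarrow{y'}C']$ there is $b:B\to B'$ with $bx=x'a$, $y'b=cy$. It is additive if $\mathfrak{s}(0)=[A\to A\oplus C\to C]$ and $\mathfrak{s}(\delta\oplus\delta')=\mathfrak{s}(\delta)\oplus\mathfrak{s}(\delta')$. If $\mathfrak{s}(\delta)=[A\xrightarrow{x}B\xrightarrow{y}C]$, one writes $A\xrightarrow{x}B\xrightarrow{y}C\overset{\delta}{\dashrightarrow}$, calls this an $\mathbb{E}$-triangle,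 calls $A\to B\to C$ a conflation, $x$ an inflation, $y$ a deflation. $(\mathcal{C},\mathbb{E},\mathfrak{s})$ is extriangulated if $\mathfrak{s}$ is an additive realization and: (ET3) for $\mathbb{E}$-triangles $A\xrightarrow{x}B\xrightarrow{y}C\overset{\delta}{\dashrightarrow}$, $A'\xrightarrow{x'}B'\xrightarrow{y'}C'\overset{\delta'}{\dashrightarrow}$ and $a,b$ with $bx=x'a$, there is $c$ with $cy=y'b$ and $a_*\delta=c^*\delta'$; (ET3)$^{\mathrm{op}}$ is the dual (given $b,c$ with $cy=y'b$, there is $a$). (ET4) for $\mathbb{E}$-triangles $A\xrightarrow{f}B\xrightarrow{f'}D\overset{\delta}{\dashrightarrow}$ and $B\xrightarrow{g}C\xrightarrow{g'}F\overset{\delta'}{\dashrightarrow}$ there are an object $E$, an $\mathbb{E}$-triangle $A\xrightarrow{h}C\xrightarrow{h'}E\overset{\delta''}{\dashrightarrow}$ with $h=gf$, and morphisms $d:D\to E$, $e:E\to F$ with $h'g=df'$, $eh'=g'$, such that $D\xrightarrow{d}E\xrightarrow{e}F$ realizes $f'_*\delta'$, $d^*\delta''=\delta$, and $f_*\delta''=e^*\delta'$; (ET4)$^{\mathrm{op}}$ is the dual. (WIC): if $gf$ is an inflation then $f$ is an inflation; if $gf$ is a deflation then $g$ is a deflation. **Proper classes.** A class $\xi$ of $\mathbb{E}$-triangles closed under isomorphisms is proper if: (a) it is closed under finite coproducts and contains all split $\mathbb{E}$-triangles (those with $\delta=0$); (b) it is closed under base change ($\delta\mapsto c^*\delta$)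 and cobase change ($\delta\mapsto a_*\delta$); (c) it is saturated: given $\mathbb{E}$-triangles $A_1\xrightarrow{x_1}B_1\xrightarrow{y_1}C\overset{\delta_1}{\dashrightarrow}$ and $A_2\xrightarrow{x_2}B_2\xrightarrow{y_2}C\overset{\delta_2}{\dashrightarrow}$, if the $\mathbb{E}$-triangle of $\delta_2$ and the $\mathbb{E}$-triangle $A_1\to M\to B_2$ realizing $y_2^*\delta_1$ are in $\xi$, then so is the $\mathbb{E}$-triangle of $\delta_1$. **Projectives and injectives.** $P$ is $\xi$-projective if for every $A\to B\to C\dashrightarrow$ in $\xi$ the sequence $0\to\mathcal{C}(P,A)\to\mathcal{C}(P,B)\to\mathcal{C}(P,C)\to0$ is exact; $\xi$-injective is dual. $\mathcal{P}(\xi)$, $\mathcal{I}(\xi)$ are the full subcategories of $\xi$-projectives and $\xi$-injectives. Enough $\xi$-projectives (resp. $\xi$-injectives): every $A$ admits an $\mathbb{E}$-triangle $K\to P\to A\dashrightarrow$ (resp. $A\to I\to K\dashrightarrow$) in $\xi$ with $P\in\mathcal{P}(\xi)$ (resp. $I\in\mathcal{I}(\xi)$). **Dimensions.** $\xi\text{-}\mathrm{pd}\,A=0$ iff $A\in\mathcal{P}(\xi)$; inductively $\xi\text{-}\mathrm{pd}\,A\le n$ if there is $K\to P\to A\dashrightarrow$ in $\xi$ with $P\in\mathcal{P}(\xi)$ and $\xi\text{-}\mathrm{pd}\,K\le n-1$; the dimension is the least such $n$, or $\infty$. $\xi\text{-}\mathrm{id}$ is dual. $\widetilde{\mathcal{P}}(\xi)$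 (resp. $\widetilde{\mathcal{I}}(\xi)$) is the class of objects of finite $\xi$-projective (resp. $\xi$-injective) dimension. **$\xi$-$\mathcal{G}$projectives and $\xi$-$\mathcal{G}$injectives.** An $\mathbb{E}$-triangle $A\to B\to C\dashrightarrow$ in $\xi$ is $\mathcal{C}(-,\mathcal{W})$-exact if $0\to\mathcal{C}(C,W)\to\mathcal{C}(B,W)\to\mathcal{C}(A,W)\to0$ is exact for all $W\in\mathcal{W}$, and $\mathcal{C}(\mathcal{W},-)$-exact if $0\to\mathcal{C}(W,A)\to\mathcal{C}(W,B)\to\mathcal{C}(W,C)\to0$ is exact for all $W\in\mathcal{W}$. A complete $\xi$-projective resolution is a complex $\cdots\to P_1\to P_0\to P_{-1}\to\cdots$ with all $P_n\in\mathcal{P}(\xi)$ together with, for each $n\in\mathbb{Z}$, a $\mathcal{C}(-,\mathcal{P}(\xi))$-exact $\mathbb{E}$-triangle $K_{n+1}\xrightarrow{g_n}P_n\xrightarrow{f_n}K_n\dashrightarrow$ in $\xi$, with differential $d_n=g_{n-1}f_n$. The objects $K_n$ so arising are the $\xi$-$\mathcal{G}$projective objects, forming $\mathcal{GP}(\xi)$. Dually, a complete $\xi$-injective coresolution has all terms $I_n\in\mathcal{I}(\xi)$ and $\mathcal{C}(\mathcal{I}(\xi),-)$-exact $\mathbb{E}$-triangles $K_{n+1}\to I_n\to K_n\dashrightarrow$ in $\xi$; the $K_n$ are the $\xi$-$\mathcal{G}$injective objects, forming $\mathcal{GI}(\xi)$. The dimensions $\xi\text{-}\mathcal{G}\mathrm{pd}$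 and $\xi\text{-}\mathcal{G}\mathrm{id}$ are defined inductively as $\xi\text{-}\mathrm{pd}$ and $\xi\text{-}\mathrm{id}$ with $\mathcal{GP}(\xi)$, $\mathcal{GI}(\xi)$ in place of $\mathcal{P}(\xi)$, $\mathcal{I}(\xi)$. **Derived functors.** A $\xi$-projective resolution $\mathbf{P}\to A$ consists of $\mathbb{E}$-triangles $K_{n+1}\to P_n\to K_n\dashrightarrow$ in $\xi$ ($n\ge0$) with $K_0=A$, $P_n\in\mathcal{P}(\xi)$, with $\mathbf{P}$ the spliced complex $\cdots\to P_1\to P_0$; $\xi\mathrm{xt}^n_\xi(A,B)=H^n(\mathcal{C}(\mathbf{P},B))$ for $n\ge0$ (independent of the choice, and isomorphic to $H^n(\mathcal{C}(A,\mathbf{I}))$ for a $\xi$-injective coresolution $B\to\mathbf{I}$, defined dually). There is a natural map $\mathcal{C}(A,B)\to\xi\mathrm{xt}^0_\xi(A,B)$ (precomposition with $P_0\to A$). **Generating.** A full subcategory $\mathcal{X}$ of $\mathcal{C}$ is generating if for all $A\in\mathcal{C}$, $\mathcal{C}(X,A)=0$ for all $X\in\mathcal{X}$ implies $A=0$. A full subcategory $\mathcal{Y}$ is cogenerating if for all $B\in\mathcal{C}$, $\mathcal{C}(B,Y)=0$ for all $Y\in\mathcal{Y}$ implies $B=0$. *)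

(* Defs.v *)
From HB Require Import structures.
From mathcomp Require Import all_boot all_order all_algebra.
From mathcomp Require Import boolp classical_sets reals ereal.

Set Implicit Arguments.
Unset Strict Implicit.
Unset Printing Implicit Defensive.

Import GRing.Theory.

Local Open Scope ring_scope.

Record preadditive_category := PreadditiveCategory {
  ob :> Type;
  mor : ob -> ob -> zmodType;
  idmor : forall A, mor A A;
  compm : forall A B C, mor B C -> mor A B -> mor A C;
  compmA : forall A B C D (h : mor C D) (g : mor B C) (f : mor A B),
    compm h (compm g f) = compm (compm h g) f;
  comp1m : forall A B (f : mor A B), compm (idmor B) f = f;
  compm1 : forall A B (f : mor A B), compm f (idmor A) = f;
  compmDl : forall A B C (g g' : mor B C) (f : mor A B),
    compm (g + g') f = compm g f + compm g' f;
  compmDr : forall A B C (g : mor B C) (f f' : mor A B),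
    compm g (f + f') = compm g f + compm g f' }.

Declare Scope category_scope.
Delimit Scope category_scope with cat.
Notation "g '∘' f" := (compm g f) (at level 40, left associativity)
  : category_scope.
Local Open Scope category_scope.

Arguments idmor {p} A.

Definition is_iso (C : preadditive_category) (A B : C) (f : mor A B) : Prop :=
  exists g : mor B A, g ∘ f = idmor A /\ f ∘ g = idmor B.

Definition is_zero_object (C : preadditive_category) (Z : C) : Prop :=
  forall A, (forall f : mor Z A, f = 0) /\ (forall f : mor A Z, f = 0).

Record biproduct (C : preadditive_category) (A B : C) := Biproduct {
  biprod_ob :> C;
  in1 : mor A biprod_ob;
  in2 : mor B biprod_ob;
  pr1 : mor biprod_ob A;
  pr2 : mor biprod_ob B;
  pr1_in1 : pr1 ∘ in1 = idmor A;
  pr2_in2 : pr2 ∘ in2 = idmor B;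
  pr1_in2 : pr1 ∘ in2 = 0;
  pr2_in1 : pr2 ∘ in1 = 0;
  biprod_id : in1 ∘ pr1 + in2 ∘ pr2 = idmor biprod_ob }.

Arguments in1 {C A B} b.
Arguments in2 {C A B} b.
Arguments pr1 {C A B} b.
Arguments pr2 {C A B} b.

Record additive_category := AdditiveCategory {
  additive_base :> preadditive_category;
  has_zero_object : exists Z : additive_base, is_zero_object Z;
  has_biproducts : forall A B : additive_base, inhabited (biproduct A B) }.

Definition sum_mor (C : preadditive_category) (A A' B B' : C)
    (S : biproduct A A') (T : biproduct B B') (f : mor A B) (g : mor A' B')
  : mor S T := in1 T ∘ f ∘ pr1 S + in2 T ∘ g ∘ pr2 S.

(** [ext E C A] is the group E(C, A); [push a d] is [a_* d] and [pull c d] is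
    [c^* d]. *)
Record additive_bifunctor (C : preadditive_category) := AdditiveBifunctor {
  ext :> C -> C -> zmodType;
  push : forall X A A', mor A A' -> ext X A -> ext X A';
  pull : forall X X' A, mor X' X -> ext X A -> ext X' A;
  push1 : forall X A (d : ext X A), push (idmor A) d = d;
  pushM : forall X A A' A'' (a' : mor A' A'') (a : mor A A') (d : ext X A),
    push (a' ∘ a) d = push a' (push a d);
  pull1 : forall X A (d : ext X A), pull (idmor X) d = d;
  pullM : forall X X' X'' A (c : mor X' X) (c' : mor X'' X') (d : ext X A),
    pull (c ∘ c') d = pull c' (pull c d);
  push_pull : forall X X' A A' (a : mor A A') (c : mor X' X) (d : ext X A),
    push a (pull c d) = pull c (push a d);
  pushD : forall X A A' (a : mor A A') (d d' : ext X A),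
    push a (d + d') = push a d + push a d';
  pullD : forall X X' A (c : mor X' X) (d d' : ext X A),
    pull c (d + d') = pull c d + pull c d';
  push_addm : forall X A A' (a a' : mor A A') (d : ext X A),
    push (a + a') d = push a d + push a' d;
  pull_addm : forall X X' A (c c' : mor X' X) (d : ext X A),
    pull (c + c') d = pull c d + pull c' d }.

(** [d ⊕ d'] is the element of [E(X ⊕ X', A ⊕ A')] with components
    [(d, 0, 0, d')] in
    [E(X, A) ⊕ E(X, A') ⊕ E(X', A) ⊕ E(X', A')]. *)
Definition sum_ext (C : preadditive_category) (E : additive_bifunctor C)
    (X X' A A' : C) (SX : biproduct X X') (SA : biproduct A A')
    (d : E X A) (d' : E X' A') : E SX SA :=
  push (in1 SA) (pull (pr1 SX) d) + push (in2 SA) (pull (pr2 SX) d').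

(** A class of triples (x, y, d), where A -x-> B -y-> X and d is in E(X, A).
    This type serves both for a realization s, [s A B X x y d] meaning
    s(d) = [A -x-> B -y-> X] (i.e. (x, y, d) is an E-triangle), and for classes
    of E-triangles. *)
Definition triangle_class (C : preadditive_category) (E : additive_bifunctor C)
  := forall A B X : C, mor A B -> mor B X -> E X A -> Prop.

Definition seq_equiv (C : preadditive_category) (A B B' X : C)
    (x : mor A B) (y : mor B X) (x' : mor A B') (y' : mor B' X) : Prop :=
  exists b : mor B B', [/\ is_iso b, b ∘ x = x' & y' ∘ b = y].

Section Extriangulated.
Variables (C : additive_category) (E : additive_bifunctor C).
Variable s : triangle_class E.

Record is_realization : Prop := IsRealization {
  realization_ex : forall (A X : C) (d : E X A),
    exists (B : C) (x : mor A B) (y : mor B X), s x y d;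
  realization_class : forall (A B B' X : C) (x : mor A B) (y : mor B X)
      (x' : mor A B') (y' : mor B' X) (d : E X A),
    s x y d -> (s x' y' d <-> seq_equiv x y x' y');
  realization_mor : forall (A B X A' B' X' : C)
      (x : mor A B) (y : mor B X) (d : E X A)
      (x' : mor A' B') (y' : mor B' X') (d' : E X' A')
      (a : mor A A') (c : mor X X'),
    s x y d -> s x' y' d' -> push a d = pull c d' ->
    exists b : mor B B', b ∘ x = x' ∘ a /\ y' ∘ b = c ∘ y }.

Record is_additive_realization : Prop := IsAdditiveRealization {
  additive_is_realization : is_realization;
  realization0 : forall (A X : C) (S : biproduct A X),
    s (in1 S) (pr2 S) (0 : E X A);
  realizationD : forall (A B X A' B' X' : C)
      (SA : biproduct A A') (SB : biproduct B B') (SX : biproduct X X')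
      (x : mor A B) (y : mor B X) (d : E X A)
      (x' : mor A' B') (y' : mor B' X') (d' : E X' A'),
    s x y d -> s x' y' d' ->
    s (sum_mor SA SB x x') (sum_mor SB SX y y') (sum_ext SX SA d d') }.

Definition ET3 : Prop :=
  forall (A B X A' B' X' : C) (x : mor A B) (y : mor B X) (d : E X A)
    (x' : mor A' B') (y' : mor B' X') (d' : E X' A')
    (a : mor A A') (b : mor B B'),
  s x y d -> s x' y' d' -> b ∘ x = x' ∘ a ->
  exists c : mor X X', c ∘ y = y' ∘ b /\ push a d = pull c d'.

Definition ET3op : Prop :=
  forall (A B X A' B' X' : C) (x : mor A B) (y : mor B X) (d : E X A)
    (x' : mor A' B') (y' : mor B' X') (d' : E X' A')
    (b : mor B B') (c : mor X X'),
  s x y d -> s x' y' d' -> c ∘ y = y' ∘ b ->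
  exists a : mor A A', b ∘ x = x' ∘ a /\ push a d = pull c d'.

Definition ET4 : Prop :=
  forall (A B D X F : C)
    (f : mor A B) (f' : mor B D) (d : E D A)
    (g : mor B X) (g' : mor X F) (d' : E F B),
  s f f' d -> s g g' d' ->
  exists (G : C) (h' : mor X G) (d'' : E G A) (u : mor D G) (v : mor G F),
    [/\ s (g ∘ f) h' d'',
        h' ∘ g = u ∘ f' /\ v ∘ h' = g',
        s u v (push f' d'),
        pull u d'' = d
      & push f d'' = pull v d'].

Definition ET4op : Prop :=
  forall (A B D X F : C)
    (f' : mor D B) (f : mor B A) (d : E A D)
    (g' : mor F X) (g : mor X B) (d' : E B F),
  s f' f d -> s g' g d' ->
  exists (G : C) (h' : mor G X) (d'' : E A G) (u : mor G D) (v : mor F G),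
    [/\ s h' (f ∘ g) d'',
        g ∘ h' = f' ∘ u /\ h' ∘ v = g',
        s v u (pull f' d'),
        push u d'' = d
      & pull f d'' = push v d'].

Record extriangulated : Prop := Extriangulated {
  extri_realization : is_additive_realization;
  extri_ET3 : ET3;
  extri_ET3op : ET3op;
  extri_ET4 : ET4;
  extri_ET4op : ET4op }.

Definition inflation (A B : C) (x : mor A B) : Prop :=
  exists (X : C) (y : mor B X) (d : E X A), s x y d.

Definition deflation (B X : C) (y : mor B X) : Prop :=
  exists (A : C) (x : mor A B) (d : E X A), s x y d.

Definition WIC : Prop :=
  (forall (A B X : C) (f : mor A B) (g : mor B X),
     inflation (g ∘ f) -> inflation f) /\
  (forall (A B X : C) (f : mor A B) (g : mor B X),
     deflation (g ∘ f) -> deflation g).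

Variable xi : triangle_class E.

(** Closure under finite coproducts is stated for binary ones: the empty
    coproduct [0 -> 0 -> 0] is split. *)
Record proper_class : Prop := ProperClass {
  proper_incl : forall (A B X : C) (x : mor A B) (y : mor B X) (d : E X A),
    xi x y d -> s x y d;
  proper_iso : forall (A B X A' B' X' : C)
      (x : mor A B) (y : mor B X) (d : E X A)
      (x' : mor A' B') (y' : mor B' X') (d' : E X' A')
      (a : mor A A') (b : mor B B') (c : mor X X'),
    is_iso a -> is_iso b -> is_iso c ->
    b ∘ x = x' ∘ a -> c ∘ y = y' ∘ b -> push a d = pull c d' ->
    xi x y d -> s x' y' d' -> xi x' y' d';
  proper_coprod : forall (A B X A' B' X' : C)
      (SA : biproduct A A') (SB : biproduct B B') (SX : biproduct X X')
      (x : mor A B) (y : mor B X) (d : E X A)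
      (x' : mor A' B') (y' : mor B' X') (d' : E X' A'),
    xi x y d -> xi x' y' d' ->
    xi (sum_mor SA SB x x') (sum_mor SB SX y y') (sum_ext SX SA d d');
  proper_split : forall (A B X : C) (x : mor A B) (y : mor B X),
    s x y (0 : E X A) -> xi x y (0 : E X A);
  proper_base : forall (A B X B' X' : C)
      (x : mor A B) (y : mor B X) (d : E X A) (c : mor X' X)
      (x' : mor A B') (y' : mor B' X'),
    xi x y d -> s x' y' (pull c d) -> xi x' y' (pull c d);
  proper_cobase : forall (A B X A' B' : C)
      (x : mor A B) (y : mor B X) (d : E X A) (a : mor A A')
      (x' : mor A' B') (y' : mor B' X),
    xi x y d -> s x' y' (push a d) -> xi x' y' (push a d);
  proper_saturated : forall (A1 B1 A2 B2 X M : C)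
      (x1 : mor A1 B1) (y1 : mor B1 X) (d1 : E X A1)
      (x2 : mor A2 B2) (y2 : mor B2 X) (d2 : E X A2)
      (m : mor A1 M) (m' : mor M B2),
    s x1 y1 d1 -> s x2 y2 d2 -> s m m' (pull y2 d1) ->
    xi x2 y2 d2 -> xi m m' (pull y2 d1) -> xi x1 y1 d1 }.

End Extriangulated.

Definition short_exact (U V W : zmodType) (f : U -> V) (g : V -> W) : Prop :=
  [/\ injective f,
      forall v, g v = 0 <-> exists u, f u = v
    & forall w, exists v, g v = w].

Definition exact_from (C : preadditive_category) (W A B X : C)
    (x : mor A B) (y : mor B X) : Prop :=
  short_exact (fun u : mor W A => x ∘ u) (fun v : mor W B => y ∘ v).

Definition exact_to (C : preadditive_category) (W A B X : C)
    (x : mor A B) (y : mor B X) : Prop :=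
  short_exact (fun u : mor X W => u ∘ y) (fun v : mor B W => v ∘ x).

Section ProperClassTheory.
Variables (C : additive_category) (E : additive_bifunctor C).
Variable xi : triangle_class E.

Definition projective (P : C) : Prop :=
  forall (A B X : C) (x : mor A B) (y : mor B X) (d : E X A),
    xi x y d -> exact_from P x y.

Definition injective_obj (I : C) : Prop :=
  forall (A B X : C) (x : mor A B) (y : mor B X) (d : E X A),
    xi x y d -> exact_to I x y.

Definition enough_projectives : Prop :=
  forall A : C, exists (K P : C) (g : mor K P) (f : mor P A) (d : E A K),
    xi g f d /\ projective P.

Definition enough_injectives : Prop :=
  forall A : C, exists (I K : C) (f : mor A I) (g : mor I K) (d : E K A),
    xi f g d /\ injective_obj I.

Fixpoint resdim_le (X : C -> Prop) (n : nat) (A : C) : Prop :=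
  if n is m.+1 then
    exists (K P : C) (g : mor K P) (f : mor P A) (d : E A K),
      [/\ xi g f d, X P & resdim_le X m K]
  else X A.

Fixpoint coresdim_le (X : C -> Prop) (n : nat) (A : C) : Prop :=
  if n is m.+1 then
    exists (I K : C) (f : mor A I) (g : mor I K) (d : E K A),
      [/\ xi f g d, X I & coresdim_le X m K]
  else X A.

Definition finite_pd (A : C) : Prop := exists n, resdim_le projective n A.
Definition finite_id (A : C) : Prop := exists n, coresdim_le injective_obj n A.

(** The differential [cpr_g (n - 1) ∘ cpr_f n] of the complex is determined by
    the other data. *)
Record complete_proj_resolution := CompleteProjResolution {
  cpr_K : int -> C;
  cpr_P : int -> C;
  cpr_g : forall n, mor (cpr_K (n + 1)) (cpr_P n);
  cpr_f : forall n, mor (cpr_P n) (cpr_K n);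
  cpr_d : forall n, E (cpr_K n) (cpr_K (n + 1));
  cpr_proj : forall n, projective (cpr_P n);
  cpr_xi : forall n, xi (cpr_g n) (cpr_f n) (cpr_d n);
  cpr_exact : forall n W, projective W -> exact_to W (cpr_g n) (cpr_f n) }.

Record complete_inj_coresolution := CompleteInjCoresolution {
  cic_K : int -> C;
  cic_I : int -> C;
  cic_g : forall n, mor (cic_K (n + 1)) (cic_I n);
  cic_f : forall n, mor (cic_I n) (cic_K n);
  cic_d : forall n, E (cic_K n) (cic_K (n + 1));
  cic_inj : forall n, injective_obj (cic_I n);
  cic_xi : forall n, xi (cic_g n) (cic_f n) (cic_d n);
  cic_exact : forall n W, injective_obj W -> exact_from W (cic_g n) (cic_f n) }.

Definition Gprojective (G : C) : Prop :=
  exists (T : complete_proj_resolution) (n : int), cpr_K T n = G.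

Definition Ginjective (G : C) : Prop :=
  exists (T : complete_inj_coresolution) (n : int), cic_K T n = G.

End ProperClassTheory.

Section Dimension.
Variable R : realType.

(** Dimensions take values in ℕ ∪ {∞}, seen inside [\bar R].  This is the
    least [n] satisfying [le], or [+oo] if there is none: infima of nonempty
    sets of naturals are attained, and that of the empty set is [+oo]. *)
Definition least_or_infty (le : nat -> Prop) : \bar R :=
  ereal_inf [set n%:R%:E | n in [set n | le n]]%classic.

Variables (C : additive_category) (E : additive_bifunctor C).
Variable xi : triangle_class E.

Definition Gpd (M : C) : \bar R :=
  least_or_infty (fun n => resdim_le xi (Gprojective xi) n M).

Definition Gid (M : C) : \bar R :=
  least_or_infty (fun n => coresdim_le xi (Ginjective xi) n M).

End Dimension.

Section Cohomology.
Variables (X : nat -> zmodType) (d : forall n, {additive X n -> X n.+1}).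

Definition cocycle n : {pred X n} := fun x => d n x == 0.

Fact cocycle_zmod_closed n : zmod_closed (@cocycle n).
Proof.
split=> [|x y]; rewrite /in_mem /= /cocycle ?raddf0 //.
by move=> /eqP dx /eqP dy; rewrite raddfB dx dy subr0.
Qed.
HB.instance Definition _ n :=
  GRing.isZmodClosed.Build (X n) (@cocycle n) (@cocycle_zmod_closed n).

Record cocycles n := Cocycle {
  cocycle_val : X n;
  cocycle_valP : cocycle_val \in @cocycle n }.
HB.instance Definition _ n := [isSub for @cocycle_val n].
HB.instance Definition _ n := [Choice of cocycles n by <:].
HB.instance Definition _ n := [SubChoice_isSubZmodule of cocycles n by <:].

Definition is_coboundary n : X n -> Prop :=
  match n with
  | 0 => fun x => x = 0
  | m.+1 => fun x => exists y, d m y = x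
  end.

Definition coboundary n : {pred cocycles n} :=
  fun z => `[< is_coboundary (val z) >].

Fact coboundary_zmod_closed n : zmod_closed (@coboundary n).
Proof.
split=> [|x y]; rewrite /in_mem /= /coboundary.
  by apply/asboolP; case: n => [|n] //=; exists 0; rewrite raddf0.
move=> /asboolP bx /asboolP by_; apply/asboolP; rewrite raddfB /=.
case: n x y bx by_ => [|n] x y /=; first by move=> -> ->; rewrite subr0.
by move=> [u <-] [v <-]; exists (u - v); rewrite raddfB.
Qed.
HB.instance Definition _ n :=
  GRing.isZmodClosed.Build (cocycles n) (@coboundary n)
    (@coboundary_zmod_closed n).

Definition cohomology n : zmodType := Quotient.quot (@coboundary n).

Definition cohomology_class n (z : cocycles n) : cohomology n :=
  (\pi_(cohomology n) z)%qT.

End Cohomology.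

Definition precomp (C : preadditive_category) (A B W : C) (f : mor A B)
    (u : mor B W) : mor A W := u ∘ f.

Fact precomp_is_zmod_morphism (C : preadditive_category) (A B W : C)
  (f : mor A B) : zmod_morphism (@precomp C A B W f).
Proof.
move=> u v; rewrite /precomp; apply/eqP; rewrite eq_sym subr_eq.
by rewrite -compmDl subrK.
Qed.
HB.instance Definition _ (C : preadditive_category) (A B W : C) (f : mor A B) :=
  GRing.isZmodMorphism.Build (mor B W) (mor A W) (@precomp C A B W f)
    (@precomp_is_zmod_morphism C A B W f).

Section DerivedFunctors.
Variables (C : additive_category) (E : additive_bifunctor C).
Variable xi : triangle_class E.

(** The syzygies of [A] are [K_0 = A] and [K_(n + 1) = pres_syz n]. *)
Definition syzygy (A : C) (syz : nat -> C) (n : nat) : C :=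
  if n is m.+1 then syz m else A.

Record proj_resolution (A : C) := ProjResolution {
  pres_syz : nat -> C;
  pres_P : nat -> C;
  pres_g : forall n, mor (syzygy A pres_syz n.+1) (pres_P n);
  pres_f : forall n, mor (pres_P n) (syzygy A pres_syz n);
  pres_d : forall n, E (syzygy A pres_syz n) (syzygy A pres_syz n.+1);
  pres_proj : forall n, projective xi (pres_P n);
  pres_xi : forall n, xi (pres_g n) (pres_f n) (pres_d n) }.

Section Complex.
Variables (A : C) (Q : proj_resolution A) (B : C).

Definition pres_diff n : mor (pres_P Q n.+1) (pres_P Q n) :=
  pres_g Q n ∘ pres_f Q n.+1.

Definition hom_complex n : zmodType := mor (pres_P Q n) B.

Definition hom_diff n : {additive hom_complex n -> hom_complex n.+1} :=
  @precomp C _ _ B (pres_diff n).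

Definition augmentation : mor (pres_P Q 0) A := pres_f Q 0.

Lemma augmentation_diff : augmentation ∘ pres_diff 0 = 0.
Proof.
have [_ ex _] := pres_proj Q 1 (pres_xi Q 0).
by apply/ex; exists (pres_f Q 1).
Qed.

Lemma augmentation_cocycle (u : mor A B) :
  (u ∘ augmentation : hom_complex 0) \in @cocycle _ hom_diff 0.
Proof.
rewrite /in_mem /= /cocycle /hom_diff /= /precomp -compmA augmentation_diff.
by apply/eqP/(addrI (u ∘ 0)); rewrite -compmDr !addr0.
Qed.

End Complex.

(** [Q] is an arbitrary choice of the resolutions computing the functors. *)
Variable Q : forall A : C, proj_resolution A.

Definition xixt (n : nat) (A B : C) : zmodType :=
  cohomology (hom_diff (Q A) B) n.

Definition xixt0_map (A B : C) (u : mor A B) : xixt 0 A B :=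
  cohomology_class (Cocycle (augmentation_cocycle (Q A) u)).

Definition xixt_vanishes (A B : C) : Prop :=
  forall i, (1 <= i)%N -> forall z : xixt i A B, z = 0.

Definition condition_star : Prop :=
  (forall N M : C, finite_pd xi M -> xixt_vanishes M N ->
     bijective (@xixt0_map M N)) /\
  (forall N M : C, finite_id xi M -> xixt_vanishes N M ->
     bijective (@xixt0_map N M)).

End DerivedFunctors.

Definition generating (C : additive_category) (X : C -> Prop) : Prop :=
  forall A : C, (forall P, X P -> forall f : mor P A, f = 0) ->
    is_zero_object A.

Definition cogenerating (C : additive_category) (Y : C -> Prop) : Prop :=
  forall B : C, (forall I, Y I -> forall f : mor B I, f = 0) ->
    is_zero_object B.

(* Main.v *)
Require Import Defs.
From mathcomp Require Import all_boot all_order all_algebra.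
From mathcomp Require Import boolp classical_sets reals ereal.

(** By passing to the opposite category it suffices to show that, if every
    object has Gorenstein projective dimension at most [m], then the [m]-th
    cosyzygies of any object are Gorenstein injective.

    A ghost is a map killing all maps from projectives, equivalently killed by
    all maps to injectives; [ξxt^n] is cohomology up to ghosts, and condition
    (star) enters only through the vanishing of ghosts [M -> N].
    - Every injective embeds into an object of projective dimension at most [m]
      (pushouts along right halves of complete resolutions), hence is a retract
      of it.  So ghosts and [ξxt^1] from an injective to an [m]-th cosyzygy
      vanish.
    - As [ξxt^i(G, P) = 0] for [G] Gorenstein projective, [P] projective and
      [i >= 1], the [m]-th cosyzygies of projectives are injective; here the
      generating hypothesis and (WIC) replace the splitting of idempotents.
    - Let [V] be an [m]-th cosyzygy of [M].  The horseshoe lemma applied to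
      [K -> P -> M] with [P] projective yields [V' -> J -> V], where [J] is
      injective and [V'] is an [m]-th cosyzygy of [K].  Iterating this to the
      left and taking cosyzygies to the right gives a complete injective
      coresolution of [V]. *)

Set Implicit Arguments.
Unset Strict Implicit.
Unset Printing Implicit Defensive.

Import Order.TTheory GRing.Theory Num.Theory.

Local Open Scope ring_scope.
Local Open Scope category_scope.

(** * Additivity of composition, [push] and [pull] *)

Section PreadditiveTheory.
Variables (C : preadditive_category).
Implicit Types A B X Y : C.

Lemma comp0m A B X (f : mor A B) : (0 : mor B X) ∘ f = 0.
Proof. by apply: (addrI ((0 : mor B X) ∘ f)); rewrite -compmDl !addr0. Qed.

Lemma compm0 A B X (f : mor B X) : f ∘ (0 : mor A B) = 0.
Proof. by apply: (addrI (f ∘ (0 : mor A B))); rewrite -compmDr !addr0. Qed.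

Lemma compNm A B X (f : mor A B) (g : mor B X) : (- g) ∘ f = - (g ∘ f).
Proof. by apply: (addrI (g ∘ f)); rewrite -compmDl !subrr comp0m. Qed.

Lemma compmN A B X (f : mor A B) (g : mor B X) : g ∘ (- f) = - (g ∘ f).
Proof. by apply: (addrI (g ∘ f)); rewrite -compmDr !subrr compm0. Qed.

Lemma compBm A B X (f : mor A B) (g g' : mor B X) :
  (g - g') ∘ f = g ∘ f - g' ∘ f.
Proof. by rewrite compmDl compNm. Qed.

Lemma compmB A B X (f f' : mor A B) (g : mor B X) :
  g ∘ (f - f') = g ∘ f - g ∘ f'.
Proof. by rewrite compmDr compmN. Qed.

Lemma is_iso_of_comps A B (f : mor A B) (g h : mor B A) :
  is_iso (g ∘ f) -> is_iso (f ∘ h) -> is_iso f.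
Proof.
move=> [u [ugf _]] [v [_ fhv]]; exists (u ∘ g); split; first by rewrite -compmA.
suff -> : u ∘ g = h ∘ v by rewrite compmA.
by rewrite -[LHS]compm1 -fhv !compmA -[u ∘ g ∘ f]compmA ugf comp1m.
Qed.

Lemma biproduct_ext A B X (S : biproduct A B) (u v : mor X S) :
  pr1 S ∘ u = pr1 S ∘ v -> pr2 S ∘ u = pr2 S ∘ v -> u = v.
Proof.
move=> e1 e2; rewrite -[u]comp1m -[v]comp1m -(biprod_id S) !compmDl -!compmA.
by rewrite e1 e2.
Qed.

Variable E : additive_bifunctor C.

Lemma push0m X A A' (d : E X A) : push (0 : mor A A') d = 0.
Proof. by apply: (addrI (push (0 : mor A A') d)); rewrite -push_addm !addr0. Qed.

Lemma push0 X A A' (a : mor A A') : push a (0 : E X A) = 0.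
Proof. by apply: (addrI (push a (0 : E X A))); rewrite -pushD !addr0. Qed.

Lemma pull0 X X' A (c : mor X' X) : pull c (0 : E X A) = 0.
Proof. by apply: (addrI (pull c (0 : E X A))); rewrite -pullD !addr0. Qed.

Lemma pushB X A A' (a : mor A A') (d d' : E X A) :
  push a (d - d') = push a d - push a d'.
Proof. by apply/eqP; rewrite eq_sym subr_eq -pushD subrK. Qed.

Lemma pullB X X' A (c : mor X' X) (d d' : E X A) :
  pull c (d - d') = pull c d - pull c d'.
Proof. by apply/eqP; rewrite eq_sym subr_eq -pullD subrK. Qed.

Lemma pull_subm X X' A (c c' : mor X' X) (d : E X A) :
  pull (c - c') d = pull c d - pull c' d.
Proof. by apply/eqP; rewrite eq_sym subr_eq -pull_addm subrK. Qed.

End PreadditiveTheory.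

(** * The opposite category *)

Section Opposite.

Definition op_preadditive (C : preadditive_category) : preadditive_category :=
  @PreadditiveCategory (ob C) (fun A B => mor B A) (@idmor C)
    (fun A B X g f => f ∘ g)
    (fun A B X Y h g f => esym (compmA f g h))
    (fun A B f => compm1 f) (fun A B f => comp1m f)
    (fun A B X g g' f => compmDr f g g')
    (fun A B X g f f' => compmDl f f' g).

(** The summands are exchanged so that [in1] and [pr2] trade places: the split triangle of the
    opposite biproduct is that of [S] read backwards. *)
Definition op_biproduct (C : preadditive_category) (A B : C)
    (S : biproduct A B) : @biproduct (op_preadditive C) B A :=
  @Biproduct (op_preadditive C) B A S (pr2 S) (pr1 S) (in2 S) (in1 S)
    (pr2_in2 S) (pr1_in1 S) (pr1_in2 S) (pr2_in1 S)
    (etrans (addrC _ _) (biprod_id S)).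

Definition unop_biproduct (C : preadditive_category) (A B : C)
    (S : @biproduct (op_preadditive C) A B) : biproduct B A :=
  @Biproduct C B A S (pr2 S) (pr1 S) (in2 S) (in1 S)
    (pr2_in2 S) (pr1_in1 S) (pr1_in2 S) (pr2_in1 S)
    (etrans (addrC _ _) (biprod_id S)).

Lemma op_zero (C : preadditive_category) (Z : C) :
  is_zero_object Z -> @is_zero_object (op_preadditive C) Z.
Proof. by move=> Z0 A; case: (Z0 A). Qed.

Definition op_additive (C : additive_category) : additive_category :=
  @AdditiveCategory (op_preadditive C)
    (let: ex_intro Z Z0 := has_zero_object C in
     ex_intro _ Z (op_zero Z0))
    (fun A B => let: inhabits T := has_biproducts B A in
                inhabits (op_biproduct T)).

Definition op_bifunctor (C : preadditive_category) (E : additive_bifunctor C) :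
    additive_bifunctor (op_preadditive C) :=
  @AdditiveBifunctor (op_preadditive C) (fun X A => E A X)
    (fun X A A' => @pull C E A A' X) (fun X X' A => @push C E A X X')
    (fun X A => @pull1 C E A X)
    (fun X A A' A'' a' a => @pullM C E A A' A'' X a a')
    (fun X A => @push1 C E A X)
    (fun X X' X'' A c c' => @pushM C E A X X' X'' c' c)
    (fun X X' A A' a c d => esym (@push_pull C E A A' X X' c a d))
    (fun X A A' => @pullD C E A A' X) (fun X X' A => @pushD C E A X X')
    (fun X A A' => @pull_addm C E A A' X)
    (fun X X' A => @push_addm C E A X X').

Definition op_class (C : preadditive_category) (E : additive_bifunctor C)
    (s : triangle_class E) : triangle_class (op_bifunctor E) :=
  fun A B X x y d => s X B A y x d.

End Opposite.

(** * Self-dual axioms *)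

Section SelfDualPart.
Variables (C : additive_category) (E : additive_bifunctor C).
Variables (s xi : triangle_class E).

(** A self-dual part of the axioms of an extriangulated category and of (WIC),
    sufficient for the theorem. *)
Record triangle_axioms : Prop := TriangleAxioms {
  tri_realization : is_realization s;
  tri_split : forall (A X : C) (S : biproduct A X),
    s (in1 S) (pr2 S) (0 : E X A);
  tri_ET3 : ET3 s;
  tri_ET3op : ET3op s;
  tri_ET4 : ET4 s;
  tri_ET4op : ET4op s;
  tri_section : forall (A B : C) (f : mor A B) (g : mor B A),
    g ∘ f = idmor A -> inflation s f;
  tri_retraction : forall (A B : C) (f : mor A B) (g : mor B A),
    g ∘ f = idmor A -> deflation s g }.

(** The last field, dual to saturation, is a consequence of it
    ([proper_cosaturated]). *)
Record proper_axioms : Prop := ProperAxioms {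
  paxiom_triangle : triangle_axioms;
  paxiom_incl : forall (A B X : C) (x : mor A B) (y : mor B X) (d : E X A),
    xi x y d -> s x y d;
  paxiom_split : forall (A B X : C) (x : mor A B) (y : mor B X),
    s x y (0 : E X A) -> xi x y (0 : E X A);
  paxiom_pull : forall (A B X B' X' : C)
      (x : mor A B) (y : mor B X) (d : E X A) (c : mor X' X)
      (x' : mor A B') (y' : mor B' X'),
    xi x y d -> s x' y' (pull c d) -> xi x' y' (pull c d);
  paxiom_push : forall (A B X A' B' : C)
      (x : mor A B) (y : mor B X) (d : E X A) (a : mor A A')
      (x' : mor A' B') (y' : mor B' X),
    xi x y d -> s x' y' (push a d) -> xi x' y' (push a d);
  paxiom_saturated : forall (A1 B1 A2 B2 X M : C)
      (x1 : mor A1 B1) (y1 : mor B1 X) (d1 : E X A1)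
      (x2 : mor A2 B2) (y2 : mor B2 X) (d2 : E X A2)
      (m : mor A1 M) (m' : mor M B2),
    s x1 y1 d1 -> s x2 y2 d2 -> s m m' (pull y2 d1) ->
    xi x2 y2 d2 -> xi m m' (pull y2 d1) -> xi x1 y1 d1;
  paxiom_cosaturated : forall (X1 B1 X2 B2 A M : C)
      (x1 : mor A B1) (y1 : mor B1 X1) (d1 : E X1 A)
      (x2 : mor A B2) (y2 : mor B2 X2) (d2 : E X2 A)
      (m : mor B2 M) (m' : mor M X1),
    s x1 y1 d1 -> s x2 y2 d2 -> s m m' (push x2 d1) ->
    xi x2 y2 d2 -> xi m m' (push x2 d1) -> xi x1 y1 d1 }.

End SelfDualPart.

Lemma op_triangle_axioms (C : additive_category) (E : additive_bifunctor C)
    (s : triangle_class E) :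
  triangle_axioms s ->
  @triangle_axioms (op_additive C) (op_bifunctor E) (op_class s).
Proof.
move=> [[rex rcl rmor] spl et3 et3o et4 et4o sec ret]; split.
- split.
  + by move=> A X d; have [B [x [y sd]]] := rex X A d; exists B, y, x.
  + move=> A B B' X x y x' y' d sd; rewrite /op_class (rcl _ _ _ _ _ _ _ _ _ sd).
    split=> -[b [[b' [b'b bb']] e1 e2]].
      exists b'; split; first by exists b.
        change (@compm C _ _ _ x b' = x').
        by rewrite -e2 -compmA bb' compm1.
      change (@compm C _ _ _ b' y' = y).
      by rewrite -e1 compmA b'b comp1m.
    change (@compm C _ _ _ x b = x') in e1.
    change (@compm C _ _ _ b y' = y) in e2.
    change (@compm C _ _ _ b b' = idmor B) in b'b.
    change (@compm C _ _ _ b' b = idmor B') in bb'.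
    exists b'; split; first by exists b.
      by rewrite -e2 compmA bb' comp1m.
    by rewrite -e1 -compmA b'b compm1.
  + move=> A B X A' B' X' x y d x' y' d' a c sd sd' e.
    have [b [e1 e2]] := rmor _ _ _ _ _ _ _ _ _ _ _ _ c a sd' sd (esym e).
    by exists b.
- by move=> A X S; exact: (spl X A (unop_biproduct S)).
- move=> A B X A' B' X' x y d x' y' d' a b sd sd' e.
  have [c [e1 e2]] := et3o _ _ _ _ _ _ _ _ _ _ _ _ b a sd' sd (esym e).
  by exists c.
- move=> A B X A' B' X' x y d x' y' d' b c sd sd' e.
  have [a [e1 e2]] := et3 _ _ _ _ _ _ _ _ _ _ _ _ c b sd' sd (esym e).
  by exists a.
- move=> A B D X F f f' d g g' d' sd sd'.
  have [G [h' [d'' [u [v [s1 [e1 e2] s2 e3 e4]]]]]] := et4o _ _ _ _ _ _ _ _ _ _ _ sd sd'.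
  by exists G, h', d'', u, v; split.
- move=> A B D X F f f' d g g' d' sd sd'.
  have [G [h' [d'' [u [v [s1 [e1 e2] s2 e3 e4]]]]]] := et4 _ _ _ _ _ _ _ _ _ _ _ sd sd'.
  by exists G, h', d'', u, v; split.
- move=> A B f g gf; have [X [x [d sd]]] := ret _ _ g f gf.
  by exists X, x, d.
- move=> A B f g gf; have [X [x [d sd]]] := sec _ _ g f gf.
  by exists X, x, d.
Qed.

Lemma op_proper_axioms (C : additive_category) (E : additive_bifunctor C)
    (s xi : triangle_class E) :
  proper_axioms s xi ->
  @proper_axioms (op_additive C) (op_bifunctor E) (op_class s) (op_class xi).
Proof.
move=> [tri incl spl pl ps sat cosat]; split.
- exact: op_triangle_axioms.
- by move=> A B X x y d; exact: incl.
- by move=> A B X x y; exact: spl.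
- by move=> A B X B' X' x y d c x' y'; exact: ps.
- by move=> A B X A' B' x y d a x' y'; exact: pl.
- move=> A1 B1 A2 B2 X M x1 y1 d1 x2 y2 d2 m m' s1 s2 sm x2i xm.
  exact: (cosat _ _ _ _ _ _ _ _ _ _ _ _ _ _ s1 s2 sm x2i xm).
- move=> X1 B1 X2 B2 A M x1 y1 d1 x2 y2 d2 m m' s1 s2 sm x2i xm.
  exact: (sat _ _ _ _ _ _ _ _ _ _ _ _ _ _ s1 s2 sm x2i xm).
Qed.

(** * Exactness properties of E-triangles and their duals *)

Section TriangleTheory.
Variables (C : additive_category) (E : additive_bifunctor C).
Variables (s : triangle_class E) (ax : triangle_axioms s).

Section OneTriangle.
Variables (A B X : C) (x : mor A B) (y : mor B X) (d : E X A).
Hypothesis sd : s x y d.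

Lemma tri_comp0 : y ∘ x = 0.
Proof.
have [S] := has_biproducts A X.
have e : push (0 : mor A A) d = pull (idmor X) (0 : E X A).
  by rewrite push0m pull0.
have [b [bx yb]] := realization_mor (tri_realization ax) sd (tri_split ax S) e.
by rewrite -[y]comp1m -yb -compmA bx compm0 compm0.
Qed.

Lemma tri_push_infl : push x d = 0.
Proof.
have [S] := has_biproducts B X.
have [c [_ ->]] := tri_ET3 ax sd (tri_split ax S) (erefl (in1 S ∘ x)).
by rewrite pull0.
Qed.

Lemma tri_extend (W : C) (u : mor A W) :
  push u d = 0 -> exists h : mor B W, h ∘ x = u.
Proof.
move=> ud; have [S] := has_biproducts W X.
have e : push u d = pull (idmor X) (0 : E X W) by rewrite ud pull0.
have [b [bx _]] := realization_mor (tri_realization ax) sd (tri_split ax S) e.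
by exists (pr1 S ∘ b); rewrite -compmA bx compmA pr1_in1 comp1m.
Qed.

Lemma tri_cofactor (W : C) (h : mor B W) :
  h ∘ x = 0 -> exists h' : mor X W, h = h' ∘ y.
Proof.
move=> hx; have [S] := has_biproducts A W.
have e : in2 S ∘ h ∘ x = in1 S ∘ (0 : mor A A) by rewrite -compmA hx !compm0.
have [c [cy _]] := tri_ET3 ax sd (tri_split ax S) e.
by exists c; rewrite cy compmA pr2_in2 comp1m.
Qed.

(** If [e] dies under [push x], then [x] extends over the middle term of a realization of [e], and
    (ET3) for this extension produces [w]. *)
Lemma tri_push_kernel (Y : C) (e : E Y A) :
  push x e = 0 -> exists w : mor Y X, e = pull w d.
Proof.
move=> xe; have [W [x1 [y1 se]]] := realization_ex (tri_realization ax) e.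
have [S] := has_biproducts B Y.
have eq0 : push x e = pull (idmor Y) (0 : E Y B) by rewrite xe pull0.
have [b [bx _]] := realization_mor (tri_realization ax) se (tri_split ax S) eq0.
have eq1 : pr1 S ∘ b ∘ x1 = x ∘ idmor A.
  by rewrite -compmA bx compmA pr1_in1 comp1m compm1.
have [c [_ ec]] := tri_ET3 ax se sd eq1.
by exists c; rewrite -ec push1.
Qed.

End OneTriangle.

End TriangleTheory.

Section DualTriangleTheory.
Variables (C : additive_category) (E : additive_bifunctor C).
Variables (s : triangle_class E) (ax : triangle_axioms s).
Let axo := op_triangle_axioms ax.

Section OneTriangle.
Variables (A B X : C) (x : mor A B) (y : mor B X) (d : E X A).
Hypothesis sd : s x y d.

Lemma tri_pull_defl : pull y d = 0.
Proof. exact: (@tri_push_infl _ _ _ axo X B A y x d sd). Qed.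

Lemma tri_lift (W : C) (u : mor W X) :
  pull u d = 0 -> exists h : mor W B, y ∘ h = u.
Proof. exact: (@tri_extend _ _ _ axo X B A y x d sd W u). Qed.

Lemma tri_factor (W : C) (h : mor W B) :
  y ∘ h = 0 -> exists h' : mor W A, h = x ∘ h'.
Proof. exact: (@tri_cofactor _ _ _ axo X B A y x d sd W h). Qed.

(** (ET4op) composes the two deflations; the kernel [G] of the composite is an extension of [A] by
    [N] of class [pull x e]. As this vanishes, [v : N -> G] has a retraction, along which the class
    [d''] of the composite is pushed to [e']. *)
Lemma tri_pull_exact (N : C) (e : E B N) :
  pull x e = 0 -> exists e' : E X N, e = pull y e'.
Proof.
move=> xe; have [W [n [n' se]]] := realization_ex (tri_realization ax) e.
have [G [h' [d'' [u [v [_ _ svu _ ed]]]]]] := tri_ET4op ax sd se.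
rewrite xe in svu.
have [r rv] := tri_extend ax svu (push0 E A (idmor N)).
exists (push r d''); rewrite -push_pull ed -pushM rv push1 //.
Qed.

End OneTriangle.

(** The difference [n] between [b] and the identity factors through [y] and is killed by [y], so it
    squares to zero. *)
Lemma tri_endo_iso (A B X : C) (x : mor A B) (y : mor B X) (d : E X A)
    (b : mor B B) :
  s x y d -> b ∘ x = x -> y ∘ b = y -> is_iso b.
Proof.
move=> sd bx yb.
have [h hy] : exists h : mor X B, b - idmor B = h ∘ y.
  by apply: (tri_cofactor ax sd); rewrite compBm comp1m bx subrr.
set n := b - idmor B in hy.
have nn : n ∘ n = 0.
  by rewrite {1}hy -compmA /n compmB yb compm1 subrr compm0.
have -> : b = idmor B + n by rewrite addrC subrK.
clearbody n; exists (idmor B - n).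
split.
  by rewrite compBm !compmDr !compm1 !comp1m nn addr0 addrK.
by rewrite compmDl !compmB !compm1 !comp1m nn subr0 subrK.
Qed.

End DualTriangleTheory.

(** * Split triangles and pushouts *)

Section Pushout.
Variables (C : additive_category) (E : additive_bifunctor C).
Variables (s : triangle_class E) (ax : triangle_axioms s).

Lemma tri_push_iso (A A' B X : C) (x : mor A B) (y : mor B X) (d : E X A)
    (b : mor A A') (b' : mor A' A) :
  b' ∘ b = idmor A -> b ∘ b' = idmor A' -> s x y d -> s (x ∘ b') y (push b d).
Proof.
move=> b'b bb' sd; have real := tri_realization ax.
have [B2 [x2 [y2 sd2]]] := realization_ex real (push b d).
have [f [fx yf]] := realization_mor real sd sd2 (esym (pull1 (push b d))).
have e : push b' (push b d) = pull (idmor X) d by rewrite -pushM b'b push1 pull1.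
have [g [gx yg]] := realization_mor real sd2 sd e.
rewrite !comp1m in yf yg.
have gf : is_iso (g ∘ f).
  apply: (tri_endo_iso ax sd); last by rewrite compmA yg.
  by rewrite -compmA fx compmA gx -compmA b'b compm1.
have fg : is_iso (f ∘ g).
  apply: (tri_endo_iso ax sd2); last by rewrite compmA yf.
  by rewrite -compmA gx compmA fx -compmA bb' compm1.
apply/(realization_class real _ _ sd2).
by exists g; split => //; apply: is_iso_of_comps fg gf.
Qed.

Lemma tri_splitting (A B X : C) (x : mor A B) (y : mor B X) :
  s x y (0 : E X A) -> exists (r : mor B A) (t : mor X B),
    [/\ r ∘ x = idmor A, y ∘ t = idmor X, r ∘ t = 0,
        x ∘ r + t ∘ y = idmor B & s t r (0 : E A X)].
Proof.
move=> sd; have yx := tri_comp0 ax sd.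
have [r rx] := tri_extend ax sd (push0 E X (idmor A)).
have [t0 yt0] := tri_lift ax sd (pull0 E A (idmor X)).
pose t := t0 - x ∘ (r ∘ t0).
have yt : y ∘ t = idmor X by rewrite compmB yt0 compmA yx comp0m subr0.
have rt : r ∘ t = 0 by rewrite compmB compmA rx comp1m subrr.
clearbody t.
have xrty : x ∘ r + t ∘ y = idmor B.
  have [h hy] : exists h, idmor B - x ∘ r - t ∘ y = h ∘ y.
    apply: (tri_cofactor ax sd).
    by rewrite !compBm -!compmA rx yx compm0 comp1m compm1 subr0 subrr.
  have h0 : h = 0.
    rewrite -[h]compm1 -yt compmA -hy !compBm -!compmA rt yt compm0.
    by rewrite comp1m compm1 subr0 subrr.
  move: hy; rewrite h0 comp0m => /eqP.
  by rewrite subr_eq0 subr_eq addrC => /eqP.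
exists r, t; split=> //.
have tyxr : t ∘ y + x ∘ r = idmor B by rewrite addrC.
exact: (tri_split ax (Biproduct yt rx yx rt tyxr)).
Qed.

(** By (ET4) the cone [E0] of the diagonal [A -> Z] is an extension of [G] by [X], split because
    [y ∘ x = 0]. Once [G] is embedded in [E0] so that [d''] restricts to [d'], (ET4op) along the
    projection [E0 -> X] produces the second triangle with the same [Z]. *)
Lemma tri_pushout (A B X H G : C) (x : mor A B) (y : mor B X) (d : E X A)
    (x' : mor A H) (y' : mor H G) (d' : E G A) :
  s x y d -> s x' y' d' ->
  exists (Z : C) (m : mor B Z) (e : mor Z G) (m' : mor H Z) (e' : mor Z X),
    s m e (push x d') /\ s m' e' (push x' d).
Proof.
move=> sd sd'; have real := tri_realization ax.
have [Z [g [g' sg]]] := realization_ex real (push x d').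
have [E0 [h' [d'' [u [v [sgx [_ _] suv ud xd]]]]]] := tri_ET4 ax sd sg.
rewrite -pushM (tri_comp0 ax sd) push0m in suv.
have vu := tri_comp0 ax suv.
have [r [t [ru vt rt _ _]]] := tri_splitting suv.
have [w ew] : exists w : mor E0 X, d'' - pull v d' = pull w d.
  by apply: (tri_push_kernel ax sd); rewrite pushB xd push_pull subrr.
(* Correcting the section [t] of [v] by [w] makes [d''] restrict to [d']. *)
pose t' := t - u ∘ (w ∘ t).
have vt' : v ∘ t' = idmor G by rewrite compmB vt compmA vu comp0m subr0.
have t'd : pull t' d'' = d'.
  rewrite pull_subm !pullM ud -ew pullB -!pullM vt pull1.
  by rewrite opprB addrC subrK.
clearbody t'.
have [p up] : exists p : mor E0 X, idmor E0 - t' ∘ v = u ∘ p.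
  by apply: (tri_factor ax suv); rewrite compmB compmA vt' comp1m compm1 subrr.
have pE : p = r ∘ (idmor E0 - t' ∘ v) by rewrite up compmA ru comp1m.
have pu : p ∘ u = idmor X.
  by rewrite pE -compmA compBm -[t' ∘ v ∘ u]compmA vu compm0 comp1m subr0.
have pt' : p ∘ t' = 0.
  by rewrite pE -compmA compBm -[t' ∘ v ∘ t']compmA vt' comp1m compm1 subrr compm0.
have tvup : t' ∘ v + u ∘ p = idmor E0 by rewrite -up addrC subrK.
have stp := tri_split ax (Biproduct vt' pu vu pt' tvup).
(* The kernel [K] of [Z -> X] is an extension of [G] by [A] of class [d'], hence isomorphic to [H];
   pulling back along [u], a section of [p], identifies [d3]. *)
have [K [h'' [d3 [u3 [v3 [s1 _ s2 _ pd3]]]]]] := tri_ET4op ax stp sgx.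
rewrite /= t'd in s2; rewrite /= in s1 pd3.
have d3E : d3 = push v3 d.
  by rewrite -[d3]pull1 -pu pullM pd3 -push_pull ud.
have [b [[b' [b'b bb']] bv3 _]] := (realization_class real _ _ s2).1 sd'.
exists Z, g, g', (h'' ∘ b'), (p ∘ h'); split=> //.
by have := tri_push_iso b'b bb' s1; rewrite d3E -pushM bv3.
Qed.

End Pushout.

(** * Cosaturation and the passage to the self-dual axioms *)

Section Cosaturation.
Variables (C : additive_category) (E : additive_bifunctor C).
Variables (s xi : triangle_class E) (proper_xi : proper_class s xi).

(** Since [push x2] kills [pull m' d1], the latter is pulled back from [d2] and its triangle lies in
    [xi]; saturation along the deflation [m'] concludes. *)
Lemma proper_cosaturated (X1 B1 X2 B2 A M : C) (x1 : mor A B1) (y1 : mor B1 X1) (d1 : E X1 A)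
    (x2 : mor A B2) (y2 : mor B2 X2) (d2 : E X2 A)
    (m : mor B2 M) (m' : mor M X1) :
  triangle_axioms s -> s x1 y1 d1 -> s x2 y2 d2 -> s m m' (push x2 d1) ->
  xi x2 y2 d2 -> xi m m' (push x2 d1) -> xi x1 y1 d1.
Proof.
move=> ax s1 s2 sm xi2 xim.
have [w ew] : exists w : mor M X2, pull m' d1 = pull w d2.
  apply: (tri_push_kernel ax s2).
  by rewrite push_pull (tri_pull_defl ax sm).
have [N [n [n' sn]]] := realization_ex (tri_realization ax) (pull m' d1).
apply: (proper_saturated proper_xi s1 sm sn xim).
by move: sn; rewrite ew; apply: proper_base xi2.
Qed.

Lemma extriangulated_proper_axioms :
  extriangulated s -> WIC s -> proper_axioms s xi.
Proof.
move=> [[real r0 _] et3 et3o et4 et4o] [wic1 wic2].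
have ax : triangle_axioms s.
  (* Split triangles with a zero object make identities inflations and deflations, so (WIC) applies
     to [g ∘ f = idmor A]. *)
  have id_tri (A : C) : inflation s (idmor A) /\ deflation s (idmor A).
    have [Z Z0] := has_zero_object C.
    have ZZ (f g : mor Z Z) : f = g by rewrite ((Z0 Z).1 f) ((Z0 Z).1 g).
    have AZ (f g : mor A Z) : f = g by rewrite ((Z0 A).2 f) ((Z0 A).2 g).
    have ZA (f g : mor Z A) : f = g by rewrite ((Z0 A).1 f) ((Z0 A).1 g).
    have e : idmor A ∘ idmor A + (0 : mor Z A) ∘ (0 : mor A Z) = idmor A.
      by rewrite comp0m addr0 comp1m.
    have e' : (0 : mor Z A) ∘ (0 : mor A Z) + idmor A ∘ idmor A = idmor A.
      by rewrite addrC.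
    split.
      exists Z, 0, 0.
      exact: (r0 _ _ (Biproduct (comp1m _) (ZZ _ _) (ZA _ _) (AZ _ _) e)).
    exists Z, 0, 0.
    exact: (r0 _ _ (Biproduct (ZZ _ _) (comp1m _) (AZ _ _) (ZA _ _) e')).
  split=> // A B f g gf.
    by apply: (wic1 _ _ _ _ g); rewrite gf; case: (id_tri A).
  by apply: (wic2 _ _ _ f); rewrite gf; case: (id_tri A).
split=> //.
- exact: proper_incl proper_xi.
- exact: proper_split proper_xi.
- exact: proper_base proper_xi.
- exact: proper_cobase proper_xi.
- exact: proper_saturated proper_xi.
- by move=> *; apply: proper_cosaturated; eauto.
Qed.

End Cosaturation.

(** * Exactness of Hom sequences *)

Section ExactSequences.
Variables (C : additive_category) (E : additive_bifunctor C).
Variables (s : triangle_class E) (ax : triangle_axioms s).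

Lemma exact_fromP (W A B X : C) (x : mor A B) (y : mor B X) (d : E X A) :
  s x y d ->
  (exact_from W x y <->
   (forall u : mor W A, x ∘ u = 0 -> u = 0) /\
   (forall v : mor W X, exists u : mor W B, y ∘ u = v)).
Proof.
move=> sd; split=> [[inj_x _ surj_y]|[inj_x surj_y]]; split=> //.
- by move=> u xu; apply: inj_x; rewrite xu compm0.
- move=> u v xuv; apply/eqP; rewrite -subr_eq0; apply/eqP/inj_x.
  by rewrite compmB xuv subrr.
- move=> v; split=> [yv|[u <-]]; last by rewrite compmA (tri_comp0 ax sd) comp0m.
  by have [u ->] := tri_factor ax sd yv; exists u.
Qed.

End ExactSequences.

Section ExactSequencesDual.
Variables (C : additive_category) (E : additive_bifunctor C).
Variables (s : triangle_class E) (ax : triangle_axioms s).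

Lemma exact_toP (W A B X : C) (x : mor A B) (y : mor B X) (d : E X A) :
  s x y d ->
  (exact_to W x y <->
   (forall u : mor X W, u ∘ y = 0 -> u = 0) /\
   (forall v : mor A W, exists u : mor B W, u ∘ x = v)).
Proof.
exact: (@exact_fromP _ _ _ (op_triangle_axioms ax) W X B A y x d).
Qed.

End ExactSequencesDual.

(** * Projective and injective objects *)

Section OppositeProjectives.
Variables (C : additive_category) (E : additive_bifunctor C).
Variable xi : triangle_class E.

Lemma op_projective (P : C) : projective xi P <->
  @injective_obj (op_additive C) (op_bifunctor E) (op_class xi) P.
Proof. by split=> projP A B X x y d; apply: projP. Qed.

Lemma op_injective (I : C) : injective_obj xi I <->
  @projective (op_additive C) (op_bifunctor E) (op_class xi) I.
Proof. by split=> injI A B X x y d; apply: injI. Qed.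

End OppositeProjectives.

Section Projectives.
Variables (C : additive_category) (E : additive_bifunctor C).
Variables (s xi : triangle_class E) (ax : proper_axioms s xi).
Let tri := paxiom_triangle ax.

Lemma proj_mono (P A B X : C) (x : mor A B) (y : mor B X) (d : E X A)
    (u : mor P A) :
  projective xi P -> xi x y d -> x ∘ u = 0 -> u = 0.
Proof.
move=> projP xid.
by case: ((exact_fromP tri P (paxiom_incl ax xid)).1 (projP _ _ _ _ _ _ xid)); auto.
Qed.

Lemma proj_lift (P A B X : C) (x : mor A B) (y : mor B X) (d : E X A)
    (v : mor P X) :
  projective xi P -> xi x y d -> exists u : mor P B, y ∘ u = v.
Proof.
move=> projP xid.
by case: ((exact_fromP tri P (paxiom_incl ax xid)).1 (projP _ _ _ _ _ _ xid)); auto.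
Qed.

Lemma proj_retract (P Q : C) (i : mor Q P) (r : mor P Q) :
  projective xi P -> r ∘ i = idmor Q -> projective xi Q.
Proof.
move=> projP ri A B X x y d xid.
apply/(exact_fromP tri Q (paxiom_incl ax xid)); split=> [u xu|v].
  rewrite -[u]compm1 -ri compmA (proj_mono projP xid (u := u ∘ r)) ?comp0m //.
  by rewrite compmA xu comp0m.
have [u yu] := proj_lift (v ∘ r) projP xid.
by exists (u ∘ i); rewrite compmA yu -compmA ri compm1.
Qed.

Lemma proj_biproduct (P Q : C) (S : biproduct P Q) :
  projective xi P -> projective xi Q -> projective xi S.
Proof.
move=> projP projQ A B X x y d xid.
apply/(exact_fromP tri S (paxiom_incl ax xid)); split=> [u xu|v].
  rewrite -[u]compm1 -(biprod_id S) compmDr !compmA.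
  rewrite (proj_mono projP xid (u := u ∘ in1 S)) ?compmA ?xu ?comp0m //.
  by rewrite (proj_mono projQ xid (u := u ∘ in2 S)) ?compmA ?xu ?comp0m ?addr0.
have [u1 yu1] := proj_lift (v ∘ in1 S) projP xid.
have [u2 yu2] := proj_lift (v ∘ in2 S) projQ xid.
exists (u1 ∘ pr1 S + u2 ∘ pr2 S).
by rewrite compmDr !compmA yu1 yu2 -!compmA -compmDr biprod_id compm1.
Qed.

End Projectives.

Section Injectives.
Variables (C : additive_category) (E : additive_bifunctor C).
Variables (s xi : triangle_class E) (ax : proper_axioms s xi).
Let axo := op_proper_axioms ax.

Lemma inj_epi (I A B X : C) (x : mor A B) (y : mor B X) (d : E X A)
    (u : mor X I) :
  injective_obj xi I -> xi x y d -> u ∘ y = 0 -> u = 0.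
Proof. by move=> /op_injective injI; exact: (@proj_mono _ _ _ _ axo I X B A y x d). Qed.

Lemma inj_extend (I A B X : C) (x : mor A B) (y : mor B X) (d : E X A)
    (v : mor A I) :
  injective_obj xi I -> xi x y d -> exists u : mor B I, u ∘ x = v.
Proof. by move=> /op_injective injI; exact: (@proj_lift _ _ _ _ axo I X B A y x d). Qed.

Lemma inj_retract (I J : C) (i : mor J I) (r : mor I J) :
  injective_obj xi I -> r ∘ i = idmor J -> injective_obj xi J.
Proof.
move=> /op_injective injI ri; apply/op_injective.
exact: (@proj_retract _ _ _ _ axo I J r i).
Qed.

Lemma inj_biproduct (I J : C) (S : biproduct I J) :
  injective_obj xi I -> injective_obj xi J -> injective_obj xi S.
Proof.
move=> /op_injective injI /op_injective injJ; apply/op_injective.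
exact: (@proj_biproduct _ _ _ _ axo J I (op_biproduct S)).
Qed.

End Injectives.

(** * Pushouts, composition and the horseshoe lemma in a proper class *)

Section ProperTriangles.
Variables (C : additive_category) (E : additive_bifunctor C).
Variables (s xi : triangle_class E) (ax : proper_axioms s xi).
Let tri := paxiom_triangle ax.

Lemma proper_push (A A' B X : C) (x : mor A B) (y : mor B X) (d : E X A)
    (u : mor A A') :
  xi x y d ->
  exists (B' : C) (x' : mor A' B') (y' : mor B' X), xi x' y' (push u d).
Proof.
move=> xid; have [B' [x' [y' sd']]] := realization_ex (tri_realization tri) (push u d).
by exists B', x', y'; apply: paxiom_push xid sd'.
Qed.

Lemma proper_pull (A B X X' : C) (x : mor A B) (y : mor B X) (d : E X A)
    (u : mor X' X) :
  xi x y d ->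
  exists (B' : C) (x' : mor A B') (y' : mor B' X'), xi x' y' (pull u d).
Proof.
move=> xid; have [B' [x' [y' sd']]] := realization_ex (tri_realization tri) (pull u d).
by exists B', x', y'; apply: paxiom_pull xid sd'.
Qed.

Lemma proper_pushout (A B X H G : C) (x : mor A B) (y : mor B X) (d : E X A)
    (x' : mor A H) (y' : mor H G) (d' : E G A) :
  xi x y d -> xi x' y' d' ->
  exists (Z : C) (m : mor B Z) (e : mor Z G) (m' : mor H Z) (e' : mor Z X),
    xi m e (push x d') /\ xi m' e' (push x' d).
Proof.
move=> xid xid'.
have [Z [m [e [m' [e' [s1 s2]]]]]] :=
  tri_pushout tri (paxiom_incl ax xid) (paxiom_incl ax xid').
exists Z, m, e, m', e'; split; first exact: paxiom_push xid' s1.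
exact: paxiom_push xid s2.
Qed.

(** By (ET4), [push f d''] is a base change of [d'], hence in [xi]; cosaturation along [f] carries
    this over to [d'']. *)
Lemma proper_comp (A B D X F : C) (f : mor A B) (f' : mor B D) (d : E D A)
    (g : mor B X) (g' : mor X F) (d' : E F B) :
  xi f f' d -> xi g g' d' ->
  exists (G : C) (h' : mor X G) (d'' : E G A) (u : mor D G) (v : mor G F),
    xi (g ∘ f) h' d'' /\ xi u v (push f' d').
Proof.
move=> xid xid'.
have [G [h' [d'' [u [v [s1 [_ _] s2 _ e]]]]]] :=
  tri_ET4 tri (paxiom_incl ax xid) (paxiom_incl ax xid').
exists G, h', d'', u, v; split; last exact: paxiom_push xid' s2.
have [M [m [m' xim]]] := proper_pull v xid'; rewrite -e in xim.
exact: (paxiom_cosaturated ax s1 (paxiom_incl ax xid) (paxiom_incl ax xim)).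
Qed.

(** The hypothesis [push i d = 0] stands in for injectivity of [I], so that the lemma serves both
    for injective coresolutions and for right halves of complete projective resolutions. *)
Lemma proper_horseshoe (A B X I A' I' X' : C)
    (x : mor A B) (y : mor B X) (d : E X A)
    (i : mor A I) (p : mor I A') (d1 : E A' A)
    (i' : mor X I') (p' : mor I' X') (d2 : E X' X) :
  xi x y d -> xi i p d1 -> xi i' p' d2 -> push i d = 0 ->
  exists (S : biproduct I' I) (B' : C) (j : mor B S) (q : mor S B') (d3 : E B' B)
    (m : mor A' B') (n : mor B' X') (d4 : E X' A'),
    xi j q d3 /\ xi m n d4.
Proof.
move=> xid xi1 xi2 id0.
(* The pushout [Z] of [B] and [I] under [A] splits as [I ⊕ X] because [push i d = 0]. *)
have [Z [m [e [m' [e' [xim xim']]]]]] := proper_pushout xid xi1.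
rewrite id0 in xim'.
have [r [t [rt _ _ _ str]]] := tri_splitting tri (paxiom_incl ax xim').
(* A second pushout, along [i'], replaces the summand [X] of [Z] by [I']. The required inflation is
   [B -> Z -> W], whose cone is an extension of [X'] by [A']. *)
have [W [k [f [k' [f' [xik xik']]]]]] := proper_pushout xi2 (paxiom_split ax str).
rewrite push0 in xik.
have [r' [t' [r'k ft' r't' kr'tf _]]] := tri_splitting tri (paxiom_incl ax xik).
have [B' [q [d3 [u [v [xij xiu]]]]]] := proper_comp xim xik'.
exists (Biproduct r'k ft' r't' (tri_comp0 tri (paxiom_incl ax xik)) kr'tf).
by exists B', (k' ∘ m), q, d3, u, v, (push e (push t d2)).
Qed.

End ProperTriangles.

(** * Ghosts, cosyzygies and bi-infinite chains *)

Section Definitions.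
Variables (C : additive_category) (E : additive_bifunctor C).
Variable xi : triangle_class E.

Definition ghost (A B : C) (u : mor A B) : Prop :=
  forall P, projective xi P -> forall h : mor P A, u ∘ h = 0.

Definition coghost (A B : C) (u : mor A B) : Prop :=
  forall I, injective_obj xi I -> forall h : mor B I, h ∘ u = 0.

(** [ξxt^1(A, B) = 0], computed by an injective coresolution of [B]: a cocycle
    of degree 1 is a [w] such that [p1 ∘ w] vanishes in the next injective
    term, which amounts to [p1 ∘ w] being a ghost. *)
Definition xixt1_zero (A B : C) : Prop :=
  forall (I L I1 L1 : C) (j : mor B I) (p : mor I L) (d : E L B)
    (j1 : mor L I1) (p1 : mor I1 L1) (d1 : E L1 L),
  xi j p d -> injective_obj xi I -> xi j1 p1 d1 -> injective_obj xi I1 ->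
  forall w : mor A I1, ghost (p1 ∘ w) ->
  exists v : mor A I, w = j1 ∘ (p ∘ v).

(** Ghosts form the kernel of the natural map from [mor A B] to [ξxt^0(A, B)], so this is its
    injectivity. *)
Definition faithful (A B : C) : Prop :=
  forall u : mor A B, ghost u -> u = 0.

Fixpoint cosyzygy (n : nat) (N K : C) : Prop :=
  if n is m.+1 then
    exists (L I : C) (j : mor L I) (p : mor I K) (d : E K L),
      [/\ cosyzygy m N L, xi j p d & injective_obj xi I]
  else K = N.

Definition proj_link (X Y : C) : Prop :=
  exists (P : C) (g : mor X P) (f : mor P Y) (d : E Y X),
    [/\ xi g f d, projective xi P
      & forall W, projective xi W -> exact_to W g f].

Definition inj_link (X Y : C) : Prop :=
  exists (I : C) (g : mor X I) (f : mor I Y) (d : E Y X),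
    [/\ xi g f d, injective_obj xi I
      & forall W, injective_obj xi W -> exact_from W g f].

(** An unindexed form of a chain over the integers through [G]: a class whose members have
    neighbours on both sides within the class. An indexed chain is recovered by choice in
    [bi_infinite_int]. *)
Definition bi_infinite (R : C -> C -> Prop) (G : C) : Prop :=
  exists K : C -> Prop, K G /\
    forall X, K X -> (exists Y, K Y /\ R Y X) /\ (exists Y, K Y /\ R X Y).

End Definitions.

(** * Vanishing of [ξxt^1] and dimension shifting *)

Section Xixt.
Variables (C : additive_category) (E : additive_bifunctor C).
Variables (s xi : triangle_class E) (ax : proper_axioms s xi).
Variable enough_proj : enough_projectives xi.
Let tri := paxiom_triangle ax.

Lemma proper_comp0 (A B X : C) (x : mor A B) (y : mor B X) (d : E X A) :
  xi x y d -> y ∘ x = 0.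
Proof. by move=> xid; apply: (tri_comp0 tri (paxiom_incl ax xid)). Qed.

Lemma proper_factor (A B X W : C) (x : mor A B) (y : mor B X) (d : E X A)
    (h : mor W B) :
  xi x y d -> y ∘ h = 0 -> exists h' : mor W A, h = x ∘ h'.
Proof. by move=> xid; apply: (tri_factor tri (paxiom_incl ax xid)). Qed.

Lemma proper_cofactor (A B X W : C) (x : mor A B) (y : mor B X) (d : E X A)
    (h : mor B W) :
  xi x y d -> h ∘ x = 0 -> exists h' : mor X W, h = h' ∘ y.
Proof. by move=> xid; apply: (tri_cofactor tri (paxiom_incl ax xid)). Qed.

Lemma ghost_deflation (A B X W : C) (x : mor A B) (y : mor B X) (d : E X A)
    (u : mor X W) :
  xi x y d -> u ∘ y = 0 -> ghost xi u.
Proof.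
move=> xid uy P projP h; have [k <-] := proj_lift ax h projP xid.
by rewrite compmA uy comp0m.
Qed.

Lemma ghost_inflation (A B X W : C) (x : mor A B) (y : mor B X) (d : E X A)
    (u : mor W A) :
  xi x y d -> x ∘ u = 0 -> ghost xi u.
Proof.
move=> xid xu P projP h; apply: (proj_mono ax projP xid).
by rewrite compmA xu comp0m.
Qed.

Lemma ghost_compr (A B X : C) (u : mor A B) (v : mor B X) :
  ghost xi v -> ghost xi (v ∘ u).
Proof. by move=> gv P projP h; rewrite -compmA gv. Qed.

Lemma ghost_proj0 (P A : C) (u : mor P A) : projective xi P -> ghost xi u -> u = 0.
Proof. by move=> projP gu; rewrite -[u]compm1 gu. Qed.

Lemma ghost_coghost (A B : C) (u : mor A B) : ghost xi u -> coghost xi u.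
Proof.
move=> gu I injI h; have [K [P [g [f [d [xid projP]]]]]] := enough_proj A.
by apply: (inj_epi ax injI xid); rewrite -compmA gu // compm0.
Qed.

Lemma coghost_ghost (A B : C) (u : mor A B) :
  enough_injectives xi -> coghost xi u -> ghost xi u.
Proof.
move=> enough_inj gu; have [I [K [f [g [d [xid injI]]]]]] := enough_inj B.
by apply: ghost_inflation xid (gu I injI f).
Qed.

(** A piece of the long exact sequence. A class in [ξxt^1(X, L)] dies in [ξxt^1(B, L)], so it comes
    from [ξxt^0(A, L)]. As [ξxt^1(A, N) = 0], every element there comes from a map [A -> I], which
    extends to [B]. *)
Lemma xixt1_zero_shift (A B X N I L : C)
    (x : mor A B) (y : mor B X) (d : E X A)
    (j : mor N I) (p : mor I L) (d' : E L N) :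
  xi x y d -> xi j p d' -> injective_obj xi I ->
  xixt1_zero xi A N -> xixt1_zero xi B L -> xixt1_zero xi X L.
Proof.
move=> xid xij injI zA zB I1 L1 I2 L2 j1 p1 d1 j2 p2 d2 xi1 injI1 xi2 injI2 w gw.
have gwy : ghost xi (p2 ∘ (w ∘ y)) by rewrite compmA; apply: ghost_compr.
have [v wy] := zB _ _ _ _ _ _ _ _ _ _ xi1 injI1 xi2 injI2 _ gwy.
have gv : ghost xi (p1 ∘ (v ∘ x)).
  apply: (ghost_inflation xi2).
  by rewrite [p1 ∘ (v ∘ x)]compmA compmA -wy -compmA (proper_comp0 xid) compm0.
have [v1 vx] := zA _ _ _ _ _ _ _ _ _ _ xij injI xi1 injI1 _ gv.
have [v2 v2x] := inj_extend ax v1 injI xid.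
have [v3 v3y] : exists v3, v - j1 ∘ (p ∘ v2) = v3 ∘ y.
  by apply: (proper_cofactor xid); rewrite compBm vx -!compmA v2x subrr.
exists v3; apply/eqP; rewrite -subr_eq0; apply/eqP/(inj_epi ax injI2 xid).
rewrite compBm -!compmA -v3y compmB (compmA p1 j1) (proper_comp0 xi1) comp0m.
by rewrite subr0 wy subrr.
Qed.

Lemma xixt1_zero_proj (P N : C) : projective xi P -> xixt1_zero xi P N.
Proof.
move=> projP I L I1 L1 j p d j1 p1 d1 xij _ xij1 _ w gw.
have [r ->] := proper_factor xij1 (ghost_proj0 projP gw).
by have [v <-] := proj_lift ax r projP xij; exists v.
Qed.

Lemma xixt1_zero_retract (A H N : C) (i : mor A H) (r : mor H A) :
  r ∘ i = idmor A -> xixt1_zero xi H N -> xixt1_zero xi A N.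
Proof.
move=> ri zH I L I1 L1 j p d j1 p1 d1 xij injI xij1 injI1 w gw.
have gwr : ghost xi (p1 ∘ (w ∘ r)) by rewrite compmA; apply: ghost_compr.
have [v wr] := zH _ _ _ _ _ _ _ _ _ _ xij injI xij1 injI1 _ gwr.
by exists (v ∘ i); rewrite -[w]compm1 -ri compmA wr -!compmA.
Qed.

(** A zigzag turns the cocycle [w] into a map [u1 : K -> P0], which extends to [P] by exactness. The
    two further links make [u : Q1 -> P0] descend to [K]: [u ∘ g1] is a ghost, hence zero on the
    projective [Q2], and maps [K2 -> P0] are determined on [Q2]. *)
Lemma xixt1_zero_links (K3 K2 K G P0 : C) :
  proj_link xi K3 K2 -> proj_link xi K2 K -> proj_link xi K G ->
  projective xi P0 -> xixt1_zero xi G P0.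
Proof.
move=> [Q2 [g2 [f2 [e2 [xig2 projQ2 ex2]]]]] [Q1 [g1 [f1 [e1 [xig1 projQ1 _]]]]].
move=> [P [g [f [e [xig projP ex]]]]] projP0.
move=> I L I1 L1 j p d j1 p1 d1 xij injI xij1 injI1 w gw.
have [r wf] : exists r, w ∘ f = j1 ∘ r.
  by apply: (proper_factor xij1); rewrite compmA gw.
have [t pt] := proj_lift ax r projP xij.
have gt : ghost xi (p ∘ (t ∘ g)).
  apply: (ghost_inflation xij1).
  by rewrite (compmA p) pt compmA -wf -compmA (proper_comp0 xig) compm0.
have [u tgf] : exists u, t ∘ g ∘ f1 = j ∘ u.
  by apply: (proper_factor xij); rewrite compmA gt.
have ug : u ∘ g1 = 0.
  have gu : ghost xi (u ∘ g1).
    apply: (ghost_inflation xij).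
    by rewrite compmA -tgf -compmA (proper_comp0 xig1) compm0.
  case: ((exact_toP tri P0 (paxiom_incl ax xig2)).1 (ex2 _ projP0)) => mono _.
  by apply: mono; apply: gu.
have [u1 uE] := proper_cofactor xig1 ug.
case: ((exact_toP tri P0 (paxiom_incl ax xig)).1 (ex _ projP0)) => _ /(_ u1) [u2 u2g].
have jug : j ∘ u2 ∘ g - t ∘ g = 0.
  apply: (inj_epi ax injI xig1).
  by rewrite compBm tgf -(compmA j) u2g uE compmA subrr.
have [v tE] : exists v, t - j ∘ u2 = v ∘ f.
  apply: (proper_cofactor xig); rewrite compBm.
  by apply/eqP; rewrite subr_eq0 eq_sym -subr_eq0 jug.
exists v; apply/eqP; rewrite -subr_eq0; apply/eqP/(inj_epi ax injI1 xig).
rewrite compBm wf -!compmA -tE compmB (compmA p j) (proper_comp0 xij) comp0m.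
by rewrite subr0 pt subrr.
Qed.

Notation Gp := (bi_infinite (proj_link xi)).

(** Each shift removes one cosyzygy step and replaces [G] by a syzygy in the same chain. *)
Lemma xixt1_zero_Gp (k : nat) (G P0 K : C) :
  Gp G -> projective xi P0 -> cosyzygy xi k P0 K -> xixt1_zero xi G K.
Proof.
move=> + projP0; elim: k G K => [|k IHk] G K [Kl [KG KlP]] /=.
  move=> ->; have [[Y1 [/KlP [[Y2 [/KlP [[Y3 [_ l3]] _] l2]] _] l1]] _] := KlP _ KG.
  exact: xixt1_zero_links l3 l2 l1 projP0.
move=> [L [I [j [p [d [syzL xij injI]]]]]].
have [[Y [KY [P [g [f [e [xig projP _]]]]]]] _] := KlP _ KG.
apply: (xixt1_zero_shift xig xij injI); last exact: xixt1_zero_proj.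
by apply: IHk syzL; exists Kl.
Qed.

Lemma xixt1_zero_Gpd (n k : nat) (M P0 K : C) :
  resdim_le xi Gp n M -> (n <= k)%N -> projective xi P0 -> cosyzygy xi k P0 K ->
  xixt1_zero xi M K.
Proof.
elim: n k M K => [|n IHn] k M K /=.
  by move=> GpM _ projP0; apply: xixt1_zero_Gp.
case: k => // k [Y [G [g [f [e [xig GpG resY]]]]]] lenk projP0 syzK.
move: (syzK) => [L [I [j [p [d [syzL xij injI]]]]]].
apply: (xixt1_zero_shift xig xij injI); last exact: xixt1_zero_Gp syzK.
exact: IHn resY _ projP0 syzL.
Qed.

(** In effect [ξxt^1(H, K)] is [ξxt^(k+1)(H, N)], beyond the projective dimension of [H]. *)
Lemma xixt1_zero_pd (n k : nat) (H N K : C) :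
  resdim_le xi (projective xi) n H -> (n <= k)%N -> cosyzygy xi k N K ->
  xixt1_zero xi H K.
Proof.
elim: n k H K => [|n IHn] k H K /=.
  by move=> projH _ _; apply: xixt1_zero_proj.
case: k => // k [Y [G [g [f [e [xig projG resY]]]]]] lenk syzK.
move: (syzK) => [L [I [j [p [d [syzL xij injI]]]]]].
apply: (xixt1_zero_shift xig xij injI); last exact: xixt1_zero_proj.
exact: IHn resY _ syzL.
Qed.

Lemma cosyzygy_add (m n : nat) (N L K : C) :
  cosyzygy xi m N L -> cosyzygy xi n L K -> cosyzygy xi (n + m) N K.
Proof.
move=> syzL; elim: n K => [|n IHn] K /=; first by move=> ->.
move=> [M [I [j [p [d [syzM xij injI]]]]]].
by exists M, I, j, p, d; split=> //; apply: IHn.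
Qed.

Lemma cosyzygy1 (N I K : C) (j : mor N I) (p : mor I K) (d : E K N) :
  xi j p d -> injective_obj xi I -> cosyzygy xi 1 N K.
Proof. by exists N, I, j, p, d. Qed.

End Xixt.

(** * Embedding into objects of finite projective dimension *)

Section GorensteinEmbedding.
Variables (C : additive_category) (E : additive_bifunctor C).
Variables (s xi : triangle_class E) (ax : proper_axioms s xi).
Let tri := paxiom_triangle ax.
Notation Gp := (bi_infinite (proj_link xi)).

Definition proj_ext_zero (G : C) : Prop :=
  forall (P B : C) (x : mor P B) (y : mor B G) (d : E G P),
  projective xi P -> xi x y d -> d = 0.

(** The right half of a complete projective resolution; unlike [Gp] this class
    is easily seen to be closed under extensions. *)
Definition right_Gp (G : C) : Prop :=
  exists K : C -> Prop, K G /\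
    forall X, K X -> proj_ext_zero X /\
      exists (P X' : C) (i : mor X P) (p : mor P X') (d : E X' X),
        [/\ xi i p d, projective xi P & K X'].

(** Lifting [f] through [y] exhibits [d] as [push a e] for some [a : K -> P0]. By exactness [a]
    extends to [P], so [push a e] vanishes. *)
Lemma proj_link_ext_zero (K G : C) : proj_link xi K G -> proj_ext_zero G.
Proof.
move=> [P [g [f [e [xig projP ex]]]]] P0 B x y d projP0 xid.
have [h yh] := proj_lift ax f projP xid.
have eq : idmor G ∘ f = y ∘ h by rewrite comp1m.
have [a [_]] := tri_ET3op tri (paxiom_incl ax xig) (paxiom_incl ax xid) eq.
case: ((exact_toP tri P0 (paxiom_incl ax xig)).1 (ex _ projP0)) => _ /(_ a) [u <-].
by rewrite pushM (tri_push_infl tri (paxiom_incl ax xig)) push0 pull1 => <-.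
Qed.

Lemma Gp_right_Gp (G : C) : Gp G -> right_Gp G.
Proof.
move=> [K [KG KP]]; exists K; split=> // X KX.
have [[Y [_ l]] [X' [KX' [P [i [p [d [xii projP _]]]]]]]] := KP _ KX.
by split; [apply: proj_link_ext_zero l | exists P, X', i, p, d].
Qed.

Lemma right_Gp_extension (A B X : C) (x : mor A B) (y : mor B X) (d : E X A) :
  xi x y d -> right_Gp A -> right_Gp X -> right_Gp B.
Proof.
move=> xid [KA [KAA KAP]] [KX [KXX KXP]].
exists (fun Z => exists (A X : C) (x : mor A Z) (y : mor Z X) (d : E X A),
  [/\ xi x y d, KA A & KX X]); split; first by exists A, X, x, y, d.
move=> {x y d xid A B X KAA KXX} Z [A [X [x [y [d [xid]]]]]].
move=> /KAP [zA [P [A' [i [p [d1 [xi1 projP KA']]]]]]].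
move=> /KXP [zX [P' [X' [i' [p' [d2 [xi2 projP' KX']]]]]]].
split=> [P0 B m n d0 projP0 xi0|].
  (* The class [d0] over [Z] restricts to 0 on [A], so it comes from a class [d'] over [X];
     saturation puts [d'] in [xi], where it vanishes. *)
  have [B1 [x1 [y1 xid1]]] := proper_pull ax x xi0.
  have [d' d0E] : exists d', d0 = pull y d'.
    exact: (tri_pull_exact tri (paxiom_incl ax xid) (zA _ _ _ _ _ projP0 xid1)).
  have [B' [x' [y' sd']]] := realization_ex (tri_realization tri) d'.
  rewrite d0E in xi0.
  have xid' := paxiom_saturated ax sd' (paxiom_incl ax xid)
    (paxiom_incl ax xi0) xid xi0.
  by rewrite d0E (zX _ _ _ _ _ projP0 xid') pull0.
(* Extensions of [X] by the projective [P] split, which is what the horseshoe asks for. *)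
have [B1 [x1 [y1 xid1]]] := proper_push ax i xid.
have id0 := zX _ _ _ _ _ projP xid1.
have [S [B' [j [q [d3 [m [n [d4 [xij xim]]]]]]]]] :=
  proper_horseshoe ax xid xi1 xi2 id0.
exists S, B', j, q, d3; split=> //; first exact: (proj_biproduct ax).
by exists A', X', m, n, d4.
Qed.

(** In the inductive step the pushout [Z] of [G] and [H] under [Y] is an extension of [G'] by [G],
    so it embeds into a projective [P] with cokernel [Z'] again in [right_Gp]. The cone [W] of
    [H -> Z -> P] is resolved by [H -> P -> W] and contains [M] with cokernel [Z']. *)
Lemma Gpd_embedding (n : nat) (M : C) :
  resdim_le xi Gp n M ->
  exists (H G : C) (h : mor M H) (k : mor H G) (d : E G M),
    [/\ xi h k d, resdim_le xi (projective xi) n H & right_Gp G].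
Proof.
elim: n M => [|n IHn] M /=.
  move=> /Gp_right_Gp [K [KM KP]].
  have [_ [P [X' [i [p [d [xii projP KX']]]]]]] := KP _ KM.
  by exists P, X', i, p, d; split=> //; exists K.
move=> [Y [G [g [f [e [xig GpG resY]]]]]].
have [H [G' [h [k [d [xih resH GrG']]]]]] := IHn _ resY.
have [Z [m [e1 [m' [e2 [xim xim']]]]]] := proper_pushout ax xig xih.
have [K [KZ KP]] := right_Gp_extension xim (Gp_right_Gp GpG) GrG'.
have [_ [P [Z' [i [p [d3 [xii projP KZ']]]]]]] := KP _ KZ.
have [W [h' [d4 [u [v [xi4 xiu]]]]]] := proper_comp ax xim' xii.
exists W, Z', u, v, (push e2 d3); split=> //; last by exists K.
by exists H, P, (i ∘ m'), h', d4.
Qed.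

Lemma inj_retract_pd (n : nat) (J : C) :
  injective_obj xi J -> resdim_le xi Gp n J ->
  exists (H : C) (i : mor J H) (r : mor H J),
    r ∘ i = idmor J /\ resdim_le xi (projective xi) n H.
Proof.
move=> injJ /Gpd_embedding [H [G [h [k [d [xih resH _]]]]]].
by have [r rh] := inj_extend ax (idmor J) injJ xih; exists H, h, r.
Qed.

End GorensteinEmbedding.

(** * Cosyzygies are Gorenstein injective *)

Section Main.
Variables (C : additive_category) (E : additive_bifunctor C).
Variables (s xi : triangle_class E) (ax : proper_axioms s xi).
Hypotheses (enough_proj : enough_projectives xi).
Hypotheses (enough_inj : enough_injectives xi).
Let tri := paxiom_triangle ax.
Notation Gp := (bi_infinite (proj_link xi)).
Notation Gi := (bi_infinite (inj_link xi)).

Lemma cosyzygy_horseshoe (m : nat) (K P M V : C)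
    (x : mor K P) (y : mor P M) (d : E M K) :
  xi x y d -> cosyzygy xi m M V ->
  exists (KV PV : C) (x' : mor KV PV) (y' : mor PV V) (d' : E V KV),
    [/\ cosyzygy xi m K KV, cosyzygy xi m P PV & xi x' y' d'].
Proof.
move=> xid; elim: m V => [|m IHm] V /=; first by move=> ->; exists K, P, x, y, d.
move=> [L [I [j [p [d1 [/IHm [KL [PL [x' [y' [d' [sK sP xid']]]]]] xij injI]]]]]].
have [IK [KV [i [q [d2 [xii injIK]]]]]] := enough_inj KL.
have id0 : push i d' = 0.
  have [u <-] := inj_extend ax i injIK xid'.
  by rewrite pushM (tri_push_infl tri (paxiom_incl ax xid')) push0.
have [S [PV [j' [q' [d3 [u [v [d4 [xij' xiu]]]]]]]]] :=
  proper_horseshoe ax xid' xii xij id0.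
exists KV, PV, u, v, d4; split=> //; first by exists KL, IK, i, q, d2.
exists PL, S, j', q', d3; split=> //; exact: (inj_biproduct ax).
Qed.

(** The object [N'] is the first cosyzygy on the way from [N] to [V]. *)
Lemma cosyzygy_pred (m : nat) (N V : C) :
  cosyzygy xi m.+1 N V -> exists N', cosyzygy xi m N' V.
Proof.
elim: m V => [|m IHm] V; first by exists V.
move=> [L [I [j [p [d [/IHm [N' syzL] xij injI]]]]]].
by exists N', L, I, j, p, d.
Qed.

Lemma Gi_injective (I : C) : injective_obj xi I -> Gi I.
Proof.
move=> injI; exists (injective_obj xi); split=> // J injJ.
suff l : inj_link xi J J by split; exists J.
have [S] := has_biproducts J J.
have sS := tri_split tri S.
exists S, (in1 S), (pr2 S), 0; split; first exact: (paxiom_split ax sS).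
  exact: (inj_biproduct ax).
move=> W _; apply/(exact_fromP tri W sS); split=> [u in1u|v].
  by rewrite -[u]comp1m -(pr1_in1 S) -compmA in1u compm0.
by exists (in2 S ∘ v); rewrite compmA pr2_in2 comp1m.
Qed.

Lemma coresdim_le_cosyzygy (m : nat) (M : C) :
  (forall V, cosyzygy xi m M V -> Gi V) -> coresdim_le xi Gi m M.
Proof.
elim: m M => [|m IHm] M GiV /=; first exact: GiV.
have [I [K [f [g [d [xif injI]]]]]] := enough_inj M.
exists I, K, f, g, d; split=> //; first exact: Gi_injective.
apply: IHm => V syzV; apply: GiV; rewrite -addn1.
by apply: cosyzygy_add syzV; apply: cosyzygy1 xif injI.
Qed.

Hypothesis gen : generating (projective xi).
(** Condition (star) in a form available in [C] and in its opposite: [ξxt^1] into all cosyzygies of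
    [N] accounts for all [ξxt^i(M, N)] with [i >= 1]. *)
Hypothesis star : forall M N : C, finite_pd xi M ->
  (forall n K, cosyzygy xi n N K -> xixt1_zero xi M K) -> faithful xi M N.
Variable m : nat.
Hypothesis Gpd_le : forall M : C, exists n, (n <= m)%N /\ resdim_le xi Gp n M.

Section InjectiveSource.
Variables (J N V : C) (k : nat).
Hypotheses (injJ : injective_obj xi J) (lemk : (m <= k)%N).
Hypothesis syzV : cosyzygy xi k N V.

Lemma inj_xixt1_zero : xixt1_zero xi J V.
Proof.
have [n [lenm GpJ]] := Gpd_le J.
have [H [i [r [ri pdH]]]] := inj_retract_pd ax injJ GpJ.
apply: (xixt1_zero_retract ri).
exact: (xixt1_zero_pd ax pdH (leq_trans lenm lemk) syzV).
Qed.

(** Composing with the retraction [r : H -> J] reduces to [H], of projective dimension at most [m].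
    There (star) applies, as cosyzygies of [V] are cosyzygies of [N] of index at least [m]. *)
Lemma inj_faithful : faithful xi J V.
Proof.
have [n [lenm GpJ]] := Gpd_le J.
have [H [i [r [ri pdH]]]] := inj_retract_pd ax injJ GpJ.
move=> u gu; rewrite -[u]compm1 -ri compmA.
suff -> : u ∘ r = 0 by rewrite comp0m.
apply: star; last exact: ghost_compr.
  by exists n.
move=> l K syzK; apply: (xixt1_zero_pd ax pdH _ (cosyzygy_add syzV syzK)).
by apply: leq_trans (leq_addl _ _); apply: leq_trans lemk.
Qed.

End InjectiveSource.

(* Ghosts out of [I] vanish, so that [I] is a retract of [V ⊕ L], where
   [V -> I -> L]; the complement exists by (WIC) and receives no nonzero map
   from a projective. *)
Lemma cosyzygy_proj_injective (P V : C) :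
  projective xi P -> cosyzygy xi m P V -> injective_obj xi V.
Proof.
move=> projP syzV.
have [I [L [j [p [d [xij injI]]]]]] := enough_inj V.
have [I1 [L1 [j1 [p1 [d1 [xij1 injI1]]]]]] := enough_inj L.
have syzL : cosyzygy xi m.+1 P L by exists V, I, j, p, d.
have faithV := inj_faithful injI (leqnn m) syzV.
have faithL := inj_faithful injI (leqnSn m) syzL.
have [n [lenm GpL]] := Gpd_le L.
have zLV := xixt1_zero_Gpd ax GpL lenm projP syzV.
(* The map [j1] is a cocycle for [ξxt^1(L, V) = 0], hence a coboundary; this makes [t] a section of
   [p] up to ghosts. *)
have [t j1E] : exists t, j1 = j1 ∘ (p ∘ t).
  apply: (zLV _ _ _ _ _ _ _ _ _ _ xij injI xij1 injI1).
  by rewrite (proper_comp0 ax xij1) => Q _ h; rewrite comp0m.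
have g1 : ghost xi (idmor L - p ∘ t).
  by apply: (ghost_inflation ax xij1); rewrite compmB compm1 -j1E subrr.
have ptp : p - p ∘ t ∘ p = 0.
  by rewrite -{1}[p]comp1m -compBm; apply: faithL; apply: ghost_compr.
have [r rE] : exists r, idmor I - t ∘ p = j ∘ r.
  by apply: (proper_factor ax xij); rewrite compmB compm1 compmA.
have g2 : ghost xi (idmor V - r ∘ j).
  apply: (ghost_inflation ax xij).
  rewrite compmB compmA -rE compBm compm1 comp1m -compmA (proper_comp0 ax xij).
  by rewrite compm0 subr0 subrr.
have rjr : r - r ∘ j ∘ r = 0.
  by rewrite -{1}[r]comp1m -compBm; apply: faithV; apply: ghost_compr.
have g3 : ghost xi (r ∘ t).
  apply: (ghost_deflation ax xij).
  have -> : r ∘ t ∘ p = r ∘ (idmor I - j ∘ r).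
    by rewrite -rE opprB addrC subrK compmA.
  by rewrite compmB compm1 compmA.
(* The identity [j ∘ r + t ∘ p = idmor I] makes [I] a retract of [V ⊕ L]; by the ghost relations,
   [sg ∘ rh] fixes every map from a projective. *)
have [S] := has_biproducts V L.
pose sg : mor I S := in1 S ∘ r + in2 S ∘ p.
pose rh : mor S I := j ∘ pr1 S + t ∘ pr2 S.
have pr1sg : pr1 S ∘ sg = r.
  by rewrite compmDr !compmA pr1_in1 pr1_in2 comp1m comp0m addr0.
have pr2sg : pr2 S ∘ sg = p.
  by rewrite compmDr !compmA pr2_in1 pr2_in2 comp1m comp0m add0r.
have rhsg : rh ∘ sg = idmor I.
  by rewrite compmDl -!compmA pr1sg pr2sg -rE subrK.
have rhin1 : rh ∘ in1 S = j.
  by rewrite compmDl -!compmA pr1_in1 pr2_in1 compm0 compm1 addr0.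
have rhE (Q : C) (f : mor Q S) :
    rh ∘ f = j ∘ (pr1 S ∘ f) + t ∘ (pr2 S ∘ f).
  by rewrite compmDl -!compmA.
clearbody sg rh.
have [K [y [d0 sd0]]] := tri_section tri rhsg.
have d00 : d0 = 0.
  by rewrite -[d0]push1 -rhsg pushM (tri_push_infl tri sd0) push0.
have xi0 : xi sg y 0 by apply: (paxiom_split ax); rewrite -d00.
have zK : is_zero_object K.
  apply: gen => Q projQ f; have [f' <-] := proj_lift ax f projQ xi0.
  suff -> : f' = sg ∘ (rh ∘ f') by rewrite compmA (proper_comp0 ax xi0) comp0m.
  apply: (biproduct_ext (S := S)).
    rewrite compmA pr1sg rhE compmDr (compmA r t) (g3 _ projQ) addr0.
    have := g2 _ projQ (pr1 S ∘ f').
    by rewrite compBm comp1m -(compmA r j) => /eqP; rewrite subr_eq0 => /eqP.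
  rewrite compmA pr2sg rhE compmDr (compmA p j) (proper_comp0 ax xij) comp0m add0r.
  have := g1 _ projQ (pr2 S ∘ f').
  by rewrite compBm comp1m -(compmA p t) => /eqP; rewrite subr_eq0 => /eqP.
(* As [K] is zero, [sg] is invertible with inverse [rh]; the [V] component of [sg ∘ rh] gives
   [r ∘ j = idmor V]. *)
have y0 : y ∘ idmor S = 0 by apply: (zK S).2.
have [h' sgh'] := proper_factor ax xi0 y0.
have sgrh : sg ∘ rh = idmor S.
  have : sg ∘ rh ∘ (sg ∘ h') = sg ∘ h' by rewrite compmA -(compmA sg) rhsg compm1.
  by rewrite -sgh' compm1.
apply: (inj_retract ax injI (i := j) (r := r)).
by rewrite -rhin1 -pr1sg compmA -(compmA (pr1 S)) sgrh compm1 pr1_in1.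
Qed.

(** Ghosts from an injective [W] to [V] and [V'] vanish. This gives injectivity on the left. For
    surjectivity, [j1 ∘ w] is a cocycle for [ξxt^1(W, V) = 0], and the map [v] bounding it lifts [w]
    up to a ghost. *)
Lemma cosyzygy_inj_link (N V N' V' J : C)
    (x : mor V J) (y : mor J V') (d : E V' V) :
  cosyzygy xi m N V -> cosyzygy xi m N' V' -> xi x y d -> injective_obj xi J ->
  inj_link xi V V'.
Proof.
move=> syzV syzV' xid injJ; exists J, x, y, d; split=> // W injW.
apply/(exact_fromP tri W (paxiom_incl ax xid)); split=> [u xu|w].
  by apply: (inj_faithful injW (leqnn m) syzV); apply: (ghost_inflation ax xid).
have [I1 [L1 [j1 [p1 [d1 [xij1 injI1]]]]]] := enough_inj V'.
have [|v j1w] := inj_xixt1_zero injW (leqnn m) syzV xid injJ xij1 injI1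
  (w := j1 ∘ w).
  by rewrite compmA (proper_comp0 ax xij1) => Q _ h; rewrite !comp0m.
exists v; apply/esym/eqP; rewrite -subr_eq0; apply/eqP.
apply: (inj_faithful injW (leqnn m) syzV'); apply: (ghost_inflation ax xij1).
by rewrite compmB j1w subrr.
Qed.

Lemma cosyzygy_Gi (M V : C) : cosyzygy xi m M V -> Gi V.
Proof.
move=> syzV; exists (fun V => exists N, cosyzygy xi m N V).
split; first by exists M.
move=> {M V syzV} V [N syzV]; split.
  have [K [P [x [y [d [xid projP]]]]]] := enough_proj N.
  have [KV [PV [x' [y' [d' [sK sP xid']]]]]] := cosyzygy_horseshoe xid syzV.
  exists KV; split; first by exists K.
  exact: (cosyzygy_inj_link sK syzV xid' (cosyzygy_proj_injective projP sP)).
(* To the right, an [m.+1]-st cosyzygy of [N] is an [m]-th cosyzygy of another object, so it stays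
   in the class. *)
have [I [V' [x [y [d [xid injI]]]]]] := enough_inj V.
have [N' syzV'] : exists N', cosyzygy xi m N' V'.
  by apply: (@cosyzygy_pred m N); exists V, I, x, y, d.
by exists V'; split; [exists N' | exact: (cosyzygy_inj_link syzV syzV' xid injI)].
Qed.

Lemma coresdim_le_bi_infinite (M : C) : coresdim_le xi Gi m M.
Proof. by apply: coresdim_le_cosyzygy => V; apply: cosyzygy_Gi. Qed.

End Main.

(** * From chains to complete resolutions *)

Section CompleteResolutions.
Variables (C : additive_category) (E : additive_bifunctor C).
Variable xi : triangle_class E.

Lemma bi_infinite_int (R : C -> C -> Prop) (G : C) :
  bi_infinite R G ->
  exists K : int -> C, K 0 = G /\ forall n, R (K (n + 1)) (K n).
Proof.
move=> [K [KG KP]].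
pose T := {X : C | K X}.
have [lt ltP] : {lt : T -> T & forall X, R (sval (lt X)) (sval X)}.
  apply: (@choice T T (fun X Y => R (sval Y) (sval X))) => -[X KX].
  by have [[Y [KY RY]] _] := KP X KX; exists (exist _ Y KY).
have [rt rtP] : {rt : T -> T & forall X, R (sval X) (sval (rt X))}.
  apply: (@choice T T (fun X Y => R (sval X) (sval Y))) => -[X KX].
  by have [_ [Y [KY RY]]] := KP X KX; exists (exist _ Y KY).
(* Indices grow along [lt] and decrease along [rt]; as [Negz k] is [-(k + 1)], it takes [k.+1] steps
   of [rt]. *)
pose G0 : T := exist _ G KG.
exists (fun n => sval (match n with
  | Posz k => iter k lt G0 | Negz k => iter k.+1 rt G0 end)).
split=> // -[k|[|k]].
- have -> : Posz k + 1 = Posz k.+1 by rewrite intS addrC.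
  exact: ltP.
- exact: rtP.
- have -> : Negz k.+1 + 1 = Negz k by rewrite !NegzE -addn1 PoszD opprD subrK.
  exact: rtP.
Qed.

Lemma Gprojective_bi_infinite (G : C) :
  Gprojective xi G <-> bi_infinite (proj_link xi) G.
Proof.
split=> [[T [n <-]]|/bi_infinite_int [K [<- KP]]].
  have l k : proj_link xi (cpr_K T (k + 1)) (cpr_K T k).
    exists (cpr_P T k), (cpr_g T k), (cpr_f T k), (cpr_d T k).
    by split; [apply: cpr_xi | apply: cpr_proj | apply: cpr_exact].
  exists (fun X => exists k, cpr_K T k = X); split; first by exists n.
  move=> _ [k <-]; split.
    by exists (cpr_K T (k + 1)); split; first by exists (k + 1).
  exists (cpr_K T (k - 1)); split; first by exists (k - 1).
  by have := l (k - 1); rewrite subrK.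
pose a n := cid (KP n); pose b n := cid (svalP (a n)).
pose c n := cid (svalP (b n)); pose e n := cid (svalP (c n)).
have [h1 h2 h3] : [/\ forall n, xi (sval (b n)) (sval (c n)) (sval (e n)),
    forall n, projective xi (sval (a n))
  & forall n W, projective xi W -> exact_to W (sval (b n)) (sval (c n))].
  by split=> n; case: (svalP (e n)).
by exists (CompleteProjResolution h2 h1 h3), 0.
Qed.

Lemma Ginjective_bi_infinite (G : C) :
  Ginjective xi G <-> bi_infinite (inj_link xi) G.
Proof.
split=> [[T [n <-]]|/bi_infinite_int [K [<- KP]]].
  have l k : inj_link xi (cic_K T (k + 1)) (cic_K T k).
    exists (cic_I T k), (cic_g T k), (cic_f T k), (cic_d T k).
    by split; [apply: cic_xi | apply: cic_inj | apply: cic_exact].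
  exists (fun X => exists k, cic_K T k = X); split; first by exists n.
  move=> _ [k <-]; split.
    by exists (cic_K T (k + 1)); split; first by exists (k + 1).
  exists (cic_K T (k - 1)); split; first by exists (k - 1).
  by have := l (k - 1); rewrite subrK.
pose a n := cid (KP n); pose b n := cid (svalP (a n)).
pose c n := cid (svalP (b n)); pose e n := cid (svalP (c n)).
have [h1 h2 h3] : [/\ forall n, xi (sval (b n)) (sval (c n)) (sval (e n)),
    forall n, injective_obj xi (sval (a n))
  & forall n W, injective_obj xi W -> exact_from W (sval (b n)) (sval (c n))].
  by split=> n; case: (svalP (e n)).
by exists (CompleteInjCoresolution h2 h1 h3), 0.
Qed.

Lemma resdim_le_sub (X Y : C -> Prop) (n : nat) (A : C) :
  (forall B, X B -> Y B) -> resdim_le xi X n A -> resdim_le xi Y n A.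
Proof.
move=> XY; elim: n A => [|n IHn] A /=; first exact: XY.
move=> [K [P [g [f [d [xid XP resK]]]]]].
by exists K, P, g, f, d; split=> //; [apply: XY | apply: IHn].
Qed.

Lemma coresdim_le_sub (X Y : C -> Prop) (n : nat) (A : C) :
  (forall B, X B -> Y B) -> coresdim_le xi X n A -> coresdim_le xi Y n A.
Proof.
move=> XY; elim: n A => [|n IHn] A /=; first exact: XY.
move=> [I [K [f [g [d [xid XI resK]]]]]].
by exists I, K, f, g, d; split=> //; [apply: XY | apply: IHn].
Qed.

End CompleteResolutions.

(** * Dimensions in the opposite category *)

Section OppositeDimensions.
Variables (C : additive_category) (E : additive_bifunctor C).
Variable xi : triangle_class E.
Let Co := op_additive C.
Let Eo : additive_bifunctor Co := op_bifunctor E.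
Let xio : triangle_class Eo := op_class xi.

Lemma op_resdim_le (X : C -> Prop) (n : nat) (A : C) :
  coresdim_le xi X n A -> @resdim_le Co Eo xio X n A.
Proof.
elim: n A => [|n IHn] A //= [I [K [f [g [d [xid XI resK]]]]]].
by exists K, I, g, f, d; split=> //; apply: IHn.
Qed.

Lemma unop_resdim_le (X : C -> Prop) (n : nat) (A : C) :
  @resdim_le Co Eo xio X n A -> coresdim_le xi X n A.
Proof.
elim: n A => [|n IHn] A //= [K [I [g [f [d [xid XI resK]]]]]].
by exists I, K, f, g, d; split=> //; apply: IHn.
Qed.

Lemma unop_coresdim_le (X : C -> Prop) (n : nat) (A : C) :
  @coresdim_le Co Eo xio X n A -> resdim_le xi X n A.
Proof.
elim: n A => [|n IHn] A //= [I [K [f [g [d [xid XI resK]]]]]].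
by exists K, I, g, f, d; split=> //; apply: IHn.
Qed.

Lemma op_proj_link (X Y : C) : inj_link xi X Y -> @proj_link Co Eo xio Y X.
Proof.
move=> [I [g [f [d [xid injI ex]]]]].
exists I, f, g, d; split=> //; first exact/op_injective.
by move=> W /op_injective injW; exact: ex.
Qed.

Lemma unop_inj_link (X Y : C) : @inj_link Co Eo xio X Y -> proj_link xi Y X.
Proof.
move=> [P [g [f [d [xid projP ex]]]]].
exists P, f, g, d; split=> //; first exact/op_projective.
by move=> W /op_projective projW; exact: ex.
Qed.

Lemma op_ghost (A B : C) (u : mor A B) :
  @ghost Co Eo xio B A u <-> coghost xi u.
Proof. by split=> gu I /op_injective injI; exact: gu. Qed.

End OppositeDimensions.

Lemma bi_infinite_flip (C : additive_category) (R R' : C -> C -> Prop) (G : C) :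
  (forall X Y, R X Y -> R' Y X) -> bi_infinite R G -> bi_infinite R' G.
Proof.
move=> RR' [K [KG KP]]; exists K; split=> // X KX.
have [[Y [KY RY]] [Z [KZ RZ]]] := KP X KX.
by split; [exists Z | exists Y]; split=> //; apply: RR'.
Qed.

(** A finite supremum [r] gives the uniform bound [Num.truncn r]: an infimum at most [r] lies below
    its successor and is therefore undercut there by some natural number [n] with [D M n]. *)
Lemma le_sup_least_or_infty (R : realType) (T : Type) (t0 : T)
    (D D' : T -> nat -> Prop) :
  (forall m, (forall M, exists n, (n <= m)%N /\ D M n) -> forall M, D' M m) ->
  (ereal_sup [set least_or_infty R (D' M) | M in [set: T]]%classic <=
   ereal_sup [set least_or_infty R (D M) | M in [set: T]]%classic)%E.
Proof.
move=> DD'.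
have ub M : (least_or_infty R (D M) <=
    ereal_sup [set least_or_infty R (D M) | M in [set: T]]%classic)%E.
  by apply: ereal_sup_ubound; exists M.
have ge0 M : (0 <= least_or_infty R (D M))%E.
  by apply: le_ereal_inf_tmp => _ [n _ <-]; rewrite lee_fin ler0n.
(* The value [+oo] is trivial, and [-oo] is excluded by the nonnegative dimension at [t0]. *)
case: ereal_sup ub => [r||] ub; last 2 first.
- exact: leey.
- by have := le_trans (ge0 t0) (ub t0).
have r0 : 0 <= r by rewrite -lee_fin (le_trans (ge0 t0)).
have {}DD' : forall M, D' M (Num.truncn r).
  apply: DD' => M.
  have : (least_or_infty R (D M) < (Num.truncn r).+1%:R%:E)%E.
    by apply: le_lt_trans (ub M) _; rewrite lte_fin truncnS_gt.
  move=> /ereal_inf_lt [_ [n Dn <-]]; rewrite lte_fin ltr_nat ltnS => len.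
  by exists n.
apply: ge_ereal_sup => _ [M _ <-]; apply: ge_ereal_inf.
by exists (Num.truncn r)%:R%:E; [exists (Num.truncn r) | rewrite lee_fin truncn_le].
Qed.

(** * Condition (star) in terms of ghosts *)

Section ConditionStar.
Variables (C : additive_category) (E : additive_bifunctor C).
Variables (s xi : triangle_class E) (ax : proper_axioms s xi).
Hypotheses (enough_proj : enough_projectives xi).
Hypotheses (enough_inj : enough_injectives xi).

(** With [L] the next cosyzygy after [B], both [ξxt^1(K, B)] and [ξxt^1(A, L)] are [ξxt^2(A, B)]. *)
Lemma xixt1_zero_syzygy (A K P N : C) (g : mor K P) (f : mor P A) (d : E A K) :
  xi g f d -> projective xi P ->
  (forall n L, cosyzygy xi n N L -> xixt1_zero xi A L) ->
  forall n L, cosyzygy xi n N L -> xixt1_zero xi K L.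
Proof.
move=> xig projP zA n B syzB I L I1 L1 j p d0 j1 p1 d1 xij injI xij1 injI1 w gw.
have [I2 [L2 [j2 [p2 [d2 [xij2 injI2]]]]]] := enough_inj L1.
have [w' w'g] := inj_extend ax w injI1 xig.
have [c cf] : exists c, j2 ∘ (p1 ∘ w') = c ∘ f.
  apply: (proper_cofactor ax xig); rewrite -!compmA w'g.
  exact: (ghost_coghost ax enough_proj gw injI2 j2).
have gc : ghost xi (p2 ∘ c).
  apply: (ghost_deflation ax xig).
  by rewrite -compmA -cf compmA (proper_comp0 ax xij2) comp0m.
have zL : xixt1_zero xi A L by apply: (zA n.+1); exists B, I, j, p, d0.
have [v cE] := zL _ _ _ _ _ _ _ _ _ _ xij1 injI1 xij2 injI2 _ gc.
have [r w'E] : exists r, w' - v ∘ f = j1 ∘ r.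
  apply: (proper_factor ax xij1); apply: (proj_mono ax projP xij2).
  by rewrite compmB compmB cf cE -!compmA subrr.
have [t pt] := proj_lift ax r projP xij.
exists (t ∘ g); rewrite (compmA p) pt compmA -w'E compBm w'g -compmA.
by rewrite (proper_comp0 ax xig) compm0 subr0.
Qed.

(** Balancing of [ξxt^1]: a zigzag turns the cocycle [u] on projectives into a cocycle [c] into
    injectives, and a map bounding [c] back into one bounding [u]. *)
Lemma xixt1_zero_coboundary (K2 P1 K P A N : C)
    (g1 : mor K2 P1) (f1 : mor P1 K) (d1 : E K K2)
    (g : mor K P) (f : mor P A) (d : E A K) (u : mor P1 N) :
  xi g1 f1 d1 -> xi g f d -> projective xi P1 -> projective xi P ->
  xixt1_zero xi A N -> ghost xi (u ∘ g1) ->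
  exists v : mor P N, u = v ∘ (g ∘ f1).
Proof.
move=> xig1 xig projP1 projP zA gu.
have [I [L [j [p [d0 [xij injI]]]]]] := enough_inj N.
have [I1 [L1 [j1 [p1 [d2 [xij1 injI1]]]]]] := enough_inj L.
have [w ju] : exists w, j ∘ u = w ∘ f1.
  apply: (proper_cofactor ax xig1); rewrite -compmA.
  exact: (ghost_coghost ax enough_proj gu injI j).
have [w' w'g] := inj_extend ax w injI xig.
have gw : ghost xi (p ∘ w).
  apply: (ghost_deflation ax xig1).
  by rewrite -compmA -ju compmA (proper_comp0 ax xij) comp0m.
have [c cf] : exists c, j1 ∘ (p ∘ w') = c ∘ f.
  apply: (proper_cofactor ax xig); rewrite -!compmA w'g.
  exact: (ghost_coghost ax enough_proj gw injI1 j1).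
have gc : ghost xi (p1 ∘ c).
  apply: (ghost_deflation ax xig).
  by rewrite -compmA -cf compmA (proper_comp0 ax xij1) comp0m.
have [v cE] := zA _ _ _ _ _ _ _ _ _ _ xij injI xij1 injI1 _ gc.
have [v' w'E] : exists v', w' - v ∘ f = j ∘ v'.
  apply: (proper_factor ax xij); apply: (proj_mono ax projP xij1).
  by rewrite compmB compmB cf cE -!compmA subrr.
exists v'; apply/eqP; rewrite -subr_eq0; apply/eqP/(proj_mono ax projP1 xij).
rewrite compmB ju !compmA -w'E compBm w'g -(compmA v).
by rewrite (proper_comp0 ax xig) compm0 subr0 subrr.
Qed.

Variable Q : forall A : C, proj_resolution xi A.

Lemma xixt_vanishesP (M N : C) :
  (forall i (u : mor (pres_P (Q M) i.+1) N), u ∘ pres_diff (Q M) i.+1 = 0 ->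
     exists v, u = v ∘ pres_diff (Q M) i) ->
  xixt_vanishes Q M N.
Proof.
move=> cob [|i] // _ z; rewrite -[z]reprK.
set c := repr z.
have cb : c \in @coboundary _ (hom_diff (Q M) N) i.+1.
  apply/asboolP; have /eqP/cob [v vE] := cocycle_valP c.
  by exists v; rewrite /= /precomp -vE.
rewrite -[RHS](raddf0 (\pi_(xixt Q i.+1 M N))%qT).
by apply/eqP; rewrite -Quotient.idealrBE subr0.
Qed.

Lemma xixt0_map_ghost (M N : C) (u : mor M N) :
  injective (@xixt0_map _ _ _ Q M N) -> ghost xi u -> u = 0.
Proof.
move=> inj0 gu; apply: inj0; rewrite /xixt0_map; congr cohomology_class.
apply: val_inj => /=; rewrite comp0m; apply: gu; exact: (pres_proj (Q M) 0).
Qed.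

Lemma condition_star_proj (M N : C) :
  condition_star Q -> finite_pd xi M ->
  (forall n K, cosyzygy xi n N K -> xixt1_zero xi M K) -> faithful xi M N.
Proof.
move=> [star _] pdM zM u; apply: xixt0_map_ghost; apply: bij_inj.
apply: star => //; apply: xixt_vanishesP => i v vd.
(* Degree [i.+1] for [M] is degree 1 for its [i]-th syzygy. *)
have zi k : forall n K, cosyzygy xi n N K ->
    xixt1_zero xi (syzygy M (pres_syz (Q M)) k) K.
  elim: k => [|k IHk] //.
  exact: xixt1_zero_syzygy (pres_xi (Q M) k) (pres_proj (Q M) k) IHk.
apply: (xixt1_zero_coboundary (pres_xi (Q M) i.+1) (pres_xi (Q M) i)).
- exact: pres_proj.
- exact: pres_proj.
- exact: (zi i 0%N).
- by apply: (ghost_deflation ax (pres_xi (Q M) i.+2)); rewrite -compmA.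
Qed.

(** In the opposite category the projective resolution of [N] is an injective coresolution, so
    [xixt1_zero] from [M] to the syzygies of [N] speaks directly of the complex computing
    [ξxt(N, M)]. *)
Lemma condition_star_inj (M N : C) :
  condition_star Q -> finite_id xi M ->
  (forall n K, @cosyzygy (op_additive C) _ (op_class xi) n N K ->
     @xixt1_zero (op_additive C) _ (op_class xi) M K) ->
  @faithful (op_additive C) _ (op_class xi) M N.
Proof.
move=> [_ star] idM zM u /op_ghost /(coghost_ghost ax enough_inj).
apply: xixt0_map_ghost; apply: bij_inj.
apply: star => //; apply: xixt_vanishesP => i v vd.
have syz k : @cosyzygy (op_additive C) _ (op_class xi) k N
    (syzygy N (pres_syz (Q N)) k).
  elim: k => [|k IHk] //.
  exists (syzygy N (pres_syz (Q N)) k), (pres_P (Q N) k).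
  exists (pres_f (Q N) k), (pres_g (Q N) k), (pres_d (Q N) k).
  split=> //; first exact: pres_xi.
  by apply/op_projective; exact: pres_proj.
have gv : @ghost (op_additive C) _ (op_class xi) _ _ (v ∘ pres_g (Q N) i.+1).
  apply/op_ghost; apply: (ghost_coghost ax enough_proj).
  by apply: (ghost_deflation ax (pres_xi (Q N) i.+2)); rewrite -compmA.
have pP k : @injective_obj (op_additive C) _ (op_class xi) (pres_P (Q N) k).
  by apply/op_projective; exact: pres_proj.
have [t tE] := zM _ _ (syz i) _ _ _ _ _ _ _ _ _ _
  (pres_xi (Q N) i) (pP i) (pres_xi (Q N) i.+1) (pP i.+1) v gv.
by exists t; rewrite tE /= /pres_diff compmA.
Qed.

End ConditionStar.

(** * Comparison of the two dimensions *)

Section Comparison.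
Variables (R : realType) (C : additive_category) (E : additive_bifunctor C).
Variables (s xi : triangle_class E) (ax : proper_axioms s xi).
Hypotheses (enough_proj : enough_projectives xi).
Hypotheses (enough_inj : enough_injectives xi).
Variable Q : forall A : C, proj_resolution xi A.
Hypothesis star : condition_star Q.

Lemma Gid_le_of_Gpd_le (m : nat) : generating (projective xi) ->
  (forall M : C, exists n, (n <= m)%N /\ resdim_le xi (Gprojective xi) n M) ->
  forall M : C, coresdim_le xi (Ginjective xi) m M.
Proof.
move=> gen Gpd_le M.
apply: (@coresdim_le_sub _ _ _ (bi_infinite (inj_link xi))).
  by move=> B /Ginjective_bi_infinite.
apply: (coresdim_le_bi_infinite ax enough_proj enough_inj gen).
  by move=> {}M N; apply: (condition_star_proj ax enough_proj enough_inj star).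
move=> {}M; have [n [lenm resM]] := Gpd_le M; exists n; split=> //.
by apply: resdim_le_sub resM => B /Gprojective_bi_infinite.
Qed.

Lemma Gpd_le_of_Gid_le (m : nat) : cogenerating (injective_obj xi) ->
  (forall M : C, exists n, (n <= m)%N /\ coresdim_le xi (Ginjective xi) n M) ->
  forall M : C, resdim_le xi (Gprojective xi) m M.
Proof.
move=> cogen Gid_le M.
apply: (@resdim_le_sub C E xi (@bi_infinite (op_additive C)
    (@inj_link (op_additive C) _ (op_class xi)))).
  move=> B GB; apply/Gprojective_bi_infinite.
  exact: (@bi_infinite_flip C _ _ B (@unop_inj_link C E xi) GB).
apply: unop_coresdim_le.
apply: (coresdim_le_bi_infinite (op_proper_axioms ax)).
- move=> A; have [I [K [f [g [d [xid injI]]]]]] := enough_inj A.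
  by exists K, I, g, f, d; split=> //; apply/op_injective.
- move=> A; have [K [P [g [f [d [xid projP]]]]]] := enough_proj A.
  by exists P, K, f, g, d; split=> //; apply/op_projective.
- move=> A A0; apply: op_zero; apply: cogen => I injI f.
  by apply: A0; apply/op_injective.
- move=> {}M N [n pdM].
  apply: (condition_star_inj ax enough_proj enough_inj star); exists n.
  apply: unop_resdim_le; apply: resdim_le_sub pdM => B.
  by move=> /op_injective.
move=> {}M; have [n [lenm resM]] := Gid_le M; exists n; split=> //.
apply: op_resdim_le; apply: coresdim_le_sub resM => B /Ginjective_bi_infinite.
exact: (@bi_infinite_flip C _ _ B (@op_proj_link C E xi)).
Qed.

End Comparison.

Theorem corollary4p8 (R : realType) (C : additive_category)
  (E : additive_bifunctor C) (s : triangle_class E)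
  (extri_s : extriangulated s) (wic_s : WIC s)
  (xi : triangle_class E) (proper_xi : proper_class s xi)
  (enough_proj : enough_projectives xi) (enough_inj : enough_injectives xi)
  (Q : forall A : C, proj_resolution xi A) (star : condition_star Q)
  (gen : generating (projective xi)) (cogen : cogenerating (injective_obj xi)) :
  ereal_sup [set Gpd R xi M | M in [set: C]]%classic =
  ereal_sup [set Gid R xi M | M in [set: C]]%classic.
Proof.
have ax := extriangulated_proper_axioms proper_xi extri_s wic_s.
(* Some object is needed to keep the suprema from being [-oo]. *)
have [Z _] := has_zero_object C.
apply/eqP; rewrite eq_le; apply/andP; split.
  apply: (le_sup_least_or_infty R Z) => m.
  exact: Gpd_le_of_Gid_le ax enough_proj enough_inj Q star m cogen.
apply: (le_sup_least_or_infty R Z) => m.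
exact: Gid_le_of_Gpd_le ax enough_proj enough_inj Q star m gen.
Qed.
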